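(* There exists an algorithm which, given a block graph $G$, computes $\operatorname{cobox}(G)$ in time polynomial in the size of $G$.
   Context: All graphs are finite and simple. A block of a graph is a maximal connected subgraph that has no cut-vertex of its own (so blocks are maximal 2-connected subgraphs, bridges, or isolated vertices). A block graph is a graph in which every block is a complete graph. The boxicity $\operatorname{box}(G)$ of a graph $G$ is the minimum $d$ such that $G$ is the intersection graph of a family of axis-parallel boxes in $\mathbb{R}^d$ (with the convention that complete graphs have boxicity $0$). The co-boxicity of $G$ is $\operatorname{cobox}(G)=\operatorname{box}(\overline{G})$, where $\overline{G}$ is the complement of $G$. (Equivalently, $\operatorname{cobox}(G)$ is the minimum number of co-interval subgraphs of $G$ whose edge sets have union $E(G)$, where a graph $H$ is co-interval if there is a map $I$ from $V(H)$ to closed real intervals with $uv\in E(H)$ iff $I(u)\cap I(v)=\emptyset$.) *)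

(* Defs.v *)
From Stdlib Require Import Reals.
From mathcomp Require Import all_boot.

Set Implicit Arguments.
Unset Strict Implicit.
Unset Printing Implicit Defensive.

Definition simple_graph (n : nat) (e : rel 'I_n) : Prop :=
  symmetric e /\ irreflexive e.

Definition complement (n : nat) (e : rel 'I_n) : rel 'I_n :=
  fun x y => (x != y) && ~~ e x y.

(* the subgraph induced on S is connected (vacuous for S empty) *)
Definition induced_connected (n : nat) (e : rel 'I_n) (S : {set 'I_n}) : Prop :=
  forall x y, x \in S -> y \in S ->
    connect [rel a b | [&& e a b, a \in S & b \in S]] x y.

Definition nonseparable (n : nat) (e : rel 'I_n) (S : {set 'I_n}) : Prop :=
  S != set0 /\ induced_connected e S /\
  forall v, v \in S -> induced_connected e (S :\ v).

Definition is_block (n : nat) (e : rel 'I_n) (S : {set 'I_n}) : Prop :=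
  nonseparable e S /\ forall T : {set 'I_n}, S \subset T -> nonseparable e T -> T = S.

Definition block_graph (n : nat) (e : rel 'I_n) : Prop :=
  forall S, is_block e S -> forall x y, x \in S -> y \in S -> x != y -> e x y.

(* h is the intersection graph of a family of axis-parallel boxes in
   R^d: vertex v gets the box prod_{i<d} [lo v i, hi v i]. For d = 0
   all boxes intersect, so exactly complete graphs have boxicity 0. *)
Definition box_rep (n : nat) (h : rel 'I_n) (d : nat) : Prop :=
  exists lo hi : 'I_n -> nat -> R,
    (forall v i, (i < d)%N -> Rle (lo v i) (hi v i)) /\
    (forall u v, u != v ->
       (h u v <-> forall i, (i < d)%N ->
                    Rle (lo u i) (hi v i) /\ Rle (lo v i) (hi u i))).

Definition boxicity_is (n : nat) (h : rel 'I_n) (d : nat) : Prop :=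
  box_rep h d /\ forall d', box_rep h d' -> (d <= d')%N.

Definition coboxicity_is (n : nat) (e : rel 'I_n) (k : nat) : Prop :=
  boxicity_is (complement e) k.

(* Model of computation: deterministic single-tape Turing machines     *)
(* with a one-way infinite tape.  States 'I_Q.+1 (start = ord0),       *)
(* tape symbols 'I_S.+3 with 0 = blank, 1 = bit "0", 2 = bit "1".      *)
(* delta = None means halt; move true = right, false = left            *)
(* (moving left at cell 0 stays at cell 0).                            *)

Record TM := mkTM {
  tm_Q : nat;
  tm_S : nat;
  tm_delta : 'I_tm_Q.+1 -> 'I_tm_S.+3 -> option ('I_tm_Q.+1 * 'I_tm_S.+3 * bool)
}.

Record config (M : TM) := Cfg {
  c_state : 'I_(tm_Q M).+1;
  c_head : nat;
  c_tape : nat -> 'I_(tm_S M).+3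
}.

Definition sym_blank (M : TM) : 'I_(tm_S M).+3 := ord0.
Definition sym_bit (M : TM) (b : bool) : 'I_(tm_S M).+3 :=
  inord (if b then 2 else 1).

Definition tm_step (M : TM) (c : config M) : config M :=
  match @tm_delta M (c_state c) (c_tape c (c_head c)) with
  | None => c
  | Some (q', a, mv) =>
      Cfg (M:=M) q' (if mv then (c_head c).+1 else (c_head c).-1)
        (fun p => if p == c_head c then a else c_tape c p)
  end.

Definition halted (M : TM) (c : config M) : Prop :=
  @tm_delta M (c_state c) (c_tape c (c_head c)) = None.

Definition tm_run (M : TM) (c : config M) (t : nat) : config M :=
  iter t (@tm_step M) c.

Definition tm_init (M : TM) (w : seq bool) : config M :=
  Cfg (M:=M) ord0 0
    (fun p => if (p < size w)%N then sym_bit M (nth false w p) else sym_blank M).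

(* output convention: the natural number k written in unary from cell 0,
   i.e. cells 0..k-1 hold bit "1" and cell k does not. *)
Definition tm_output (M : TM) (c : config M) (k : nat) : Prop :=
  (forall p, (p < k)%N -> c_tape c p = sym_bit M true) /\
  c_tape c k <> sym_bit M true.

(* Input encoding of a graph on 'I_n: its adjacency matrix, row-major,
   n^2 bits. *)
Definition adj_nat (n : nat) (e : rel 'I_n) (i j : nat) : bool :=
  [exists x : 'I_n, exists y : 'I_n, [&& val x == i, val y == j & e x y]].

Definition encode_graph (n : nat) (e : rel 'I_n) : seq bool :=
  [seq adj_nat e (p %/ n) (p %% n) | p <- iota 0 (n * n)].

(* Main.v *)
(* In a co-interval subgraph H of a block graph G let u be the vertex whose
   interval has the least right end and v the one whose interval has the greatest
   left end. If I(x) lies to the left of I(y), then u - y - x - v - u is a closed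
   walk, so xy touches uv or lies in the block of uv. Conversely, the set E_uv of
   all edges with one of these two properties is co-interval. Hence cobox(G) is
   the least number of edges uv of G such that the sets E_uv cover E(G).

   This covering problem is generalised to induced subgraphs in which some
   vertices already count as touched ("sated") and others have to be touched
   ("needy"). A leaf block contains simplicial vertices, and local exchange
   arguments show that these can be removed one after the other, at a cost of 0
   or 1, without changing the optimum.

   The resulting greedy procedure is a loop over pairs of vertices whose tests
   are first-order queries. It runs on bit tracks laid along the adjacency
   matrix; every elementary operation is one finite-state sweep over the tape,
   and all loops have the length of the tape, whence the polynomial bound. *)
Require Import Defs.
From Stdlib Require Import Reals Classical FunctionalExtensionality.
From mathcomp Require Import all_boot zify.

Set Implicit Arguments.
Unset Strict Implicit.
Unset Printing Implicit Defensive.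

(** * Sweep machines and Turing machines *)

(** The local notions [simplicial] and [leafy] replace them, and a pair spans an edge if the four
    vertices are pairwise adjacent. The machine tries all pairs of vertices blindly. The block
    property enters at two points: cobox(G) equals the covering optimum, and some rule applies as
    long as vertices are left. The exchanges are delicate because a chosen pair does two things at
    once: it touches its ends and it spans its block. Needy vertices arise when the cover of a
    removed edge can be assumed, without loss, to touch a given vertex. Two quantities control the
    run: the optimum of the remaining instance plus the cost spent is invariant, and the cost spent
    plus the number of remaining vertices never grows. The latter bounds the result by n, so its
    unary form fits on the tape. *)

Section SweepMachine.
Variable cell : finType.

(** One bit carried from left to right is enough to shift a track or to look for a marked cell; its
    value at the end of the tape selects the next instruction. *)
Record instr := Instr {
  i_trans : bool -> cell -> bool * cell;
  i_next : bool -> nat }.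

Definition stop_instr : instr := Instr (fun s c => (s, c)) (fun=> 0).

Fixpoint sweep (f : bool -> cell -> bool * cell) s (w : seq cell) :=
  if w is c :: w' then
    ((sweep f (f s c).1 w').1, (f s c).2 :: (sweep f (f s c).1 w').2)
  else (s, [::]).

Lemma size_sweep f s w : size (sweep f s w).2 = size w.
Proof. by elim: w s => //= c w IH s; rewrite IH. Qed.

Definition sweep_step (code : seq instr) (x : nat * seq cell) :=
  if x.1 < size code then
    let i := nth stop_instr code x.1 in
    let r := sweep (i_trans i) false x.2 in
    (minn (i_next i r.1) (size code), r.2)
  else x.

Variables (code : seq instr) (inp : bool -> cell) (out : cell -> bool).

(* [inl false]: loading the input; [inl true]: halted; [(pc, None)]: moving back
   to cell 0 before the sweep at [pc] (or, if [pc = size code], writing the output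
   on the way); [(pc, Some s)]: sweeping with carry [s]. *)
Definition tm_ctl := (bool + 'I_(size code).+1 * option bool)%type.
(* The boolean marks cell 0. *)
Definition tm_sym := (bool * cell)%type.

Definition encq (x : tm_ctl) : 'I_#|{: tm_ctl}|.+1 := lift ord0 (enum_rank x).
Definition decq (q : 'I_#|{: tm_ctl}|.+1) : option tm_ctl :=
  omap enum_val (unlift ord0 q).

Lemma encqK x : decq (encq x) = Some x.
Proof. by rewrite /decq /encq liftK /= enum_rankK. Qed.

Lemma decq0 : decq ord0 = None.
Proof. by rewrite /decq unlift_none. Qed.

Definition bits (b : bool) : 'I_#|{: tm_sym}|.+3 := inord (if b then 2 else 1).
Definition encs (y : tm_sym) : 'I_#|{: tm_sym}|.+3 :=
  lift ord0 (lift ord0 (lift ord0 (enum_rank y))).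
Definition decs (a : 'I_#|{: tm_sym}|.+3) : option (bool + tm_sym) :=
  if unlift ord0 a is Some a1 then
    if unlift ord0 a1 is Some a2 then
      if unlift ord0 a2 is Some a3 then Some (inr (enum_val a3))
      else Some (inl true)
    else Some (inl false)
  else None.

Lemma encsK y : decs (encs y) = Some (inr y).
Proof. by rewrite /decs /encs !liftK /= enum_rankK. Qed.

Lemma decs0 : decs ord0 = None.
Proof. by rewrite /decs unlift_none. Qed.

Lemma bitsK b : decs (bits b) = Some (inl b).
Proof.
have -> : bits b = if b then lift ord0 (lift ord0 ord0) else lift ord0 ord0.
  by apply: val_inj; case: b; rewrite /bits /= inordK.
by rewrite /decs; case: b; rewrite !liftK ?unlift_none.
Qed.

Definition trans_at (pc : nat) := i_trans (nth stop_instr code pc).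

(** The start state has no decoding and serves only for the first step, which marks cell 0. The mark
    is what later stops the way back, because a head at cell 0 does not notice that it cannot move
    left. *)
Definition tm_of_delta (q : 'I_#|{: tm_ctl}|.+1) (a : 'I_#|{: tm_sym}|.+3) :
  option ('I_#|{: tm_ctl}|.+1 * 'I_#|{: tm_sym}|.+3 * bool) :=
  match decq q, decs a with
  | None, Some (inl b) => Some (encq (inl false), encs (true, inp b), true)
  | Some (inl false), Some (inl b) =>
      Some (encq (inl false), encs (false, inp b), true)
  | Some (inl false), None => Some (encq (inr (ord0, None)), ord0, false)
  | Some (inr (pc, None)), Some (inr (first, c)) =>
      if pc < size code then
        if first then
          Some (encq (inr (pc, Some (trans_at pc false c).1)),
                encs (true, (trans_at pc false c).2), true)
        else Some (q, a, false)
      else Some (encq (if first then inl true else inr (pc, None)),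
                 bits (out c), false)
  | Some (inr (pc, Some s)), Some (inr (first, c)) =>
      Some (encq (inr (pc, Some (trans_at pc s c).1)),
            encs (first, (trans_at pc s c).2), true)
  | Some (inr (pc, Some s)), None =>
      Some (encq (inr (inord (minn (i_next (nth stop_instr code pc) s)
                                   (size code)), None)), ord0, false)
  | _, _ => None
  end.

Definition tm_of : TM := mkTM tm_of_delta.

Lemma sym_bitK b : decs (sym_bit tm_of b) = Some (inl b).
Proof. exact: bitsK. Qed.

Definition cfg (q : 'I_#|{: tm_ctl}|.+1) h (w : seq 'I_#|{: tm_sym}|.+3) :
  config tm_of := @Cfg tm_of q h (nth ord0 w).

Lemma nth_set_cat (T : Type) (x0 : T) pre a post b :
  (fun p => if p == size pre then b else nth x0 (pre ++ a :: post) p) =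
  nth x0 (pre ++ b :: post).
Proof.
apply: functional_extensionality => p; rewrite !nth_cat.
case: eqP => [->|np]; first by rewrite ltnn subnn.
case: ltnP => // le; have : 0 < p - size pre by lia.
by case: (p - size pre).
Qed.

Lemma step_on q q' pre a b post mv :
  tm_of_delta q a = Some (q', b, mv) ->
  tm_step (cfg q (size pre) (pre ++ a :: post)) =
  cfg q' (if mv then (size pre).+1 else (size pre).-1) (pre ++ b :: post).
Proof.
move=> H; rewrite /tm_step /cfg /=.
rewrite nth_cat ltnn subnn /= H.
by rewrite nth_set_cat.
Qed.

Lemma step_end q q' w :
  tm_of_delta q ord0 = Some (q', ord0, false) ->
  tm_step (cfg q (size w) w) = cfg q' (size w).-1 w.
Proof.
move=> H; rewrite /tm_step /cfg /=.
rewrite nth_default // H; congr (@Cfg tm_of).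
apply: functional_extensionality => p; case: eqP => // ->.
by rewrite nth_default.
Qed.

Definition marked (w : seq cell) : seq 'I_#|{: tm_sym}|.+3 :=
  if w is c :: w' then encs (true, c) :: [seq encs (false, c) | c <- w']
  else [::].

Lemma size_marked w : size (marked w) = size w.
Proof. by case: w => //= c w; rewrite size_map. Qed.

Lemma run_load w pre :
  iter (size w) (@tm_step tm_of)
    (cfg (encq (inl false)) (size pre) (pre ++ [seq bits b | b <- w])) =
  cfg (encq (inl false)) (size pre + size w)
    (pre ++ [seq encs (false, inp b) | b <- w]).
Proof.
elim: w pre => [|b w IH] pre /=; first by rewrite addn0.
rewrite -iterS iterSr
  (@step_on _ (encq (inl false)) _ _ (encs (false, inp b)) _ true); last first.
  by rewrite /tm_of_delta encqK bitsK.
by have := IH (rcons pre (encs (false, inp b)));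
  rewrite size_rcons !cat_rcons => ->; rewrite addSnnS.
Qed.

Lemma run_sweep (pc : 'I_(size code).+1) s w pre :
  iter (size w) (@tm_step tm_of)
    (cfg (encq (inr (pc, Some s))) (size pre)
       (pre ++ [seq encs (false, c) | c <- w])) =
  cfg (encq (inr (pc, Some (sweep (trans_at pc) s w).1))) (size pre + size w)
    (pre ++ [seq encs (false, c) | c <- (sweep (trans_at pc) s w).2]).
Proof.
elim: w pre s => [|c w IH] pre s /=; first by rewrite addn0.
rewrite -iterS iterSr
  (@step_on _ (encq (inr (pc, Some (trans_at pc s c).1))) _ _
     (encs (false, (trans_at pc s c).2)) _ true); last first.
  by rewrite /tm_of_delta encqK encsK.
have := IH (rcons pre (encs (false, (trans_at pc s c).2))) (trans_at pc s c).1.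
by rewrite size_rcons !cat_rcons => ->; rewrite addSnnS.
Qed.

Lemma run_back (pc : 'I_(size code).+1) c w post : pc < size code ->
  iter (size w) (@tm_step tm_of)
    (cfg (encq (inr (pc, None))) (size w) (marked (c :: w) ++ post)) =
  cfg (encq (inr (pc, None))) 0 (marked (c :: w) ++ post).
Proof.
move=> ltpc; elim/last_ind: w post => [|w d IH] post //.
rewrite size_rcons iterSr /marked map_rcons -rcons_cons cat_rcons.
rewrite -[X in cfg _ X]/(size (c :: w)) -(size_marked (c :: w)).
rewrite (@step_on _ (encq (inr (pc, None))) _ _ (encs (false, d)) _ false);
  last by rewrite /tm_of_delta encqK encsK ltpc.
by rewrite size_marked /=; apply: IH.
Qed.

(** With m cells: m - 1 moves back to the mark, m cells rewritten, and one turn at the blank behind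
    them. *)
Lemma run_step (pc : 'I_(size code).+1) w : pc < size code -> 0 < size w ->
  let x := sweep_step code (pc : nat, w) in
  iter (2 * size w) (@tm_step tm_of)
    (cfg (encq (inr (pc, None))) (size w).-1 (marked w)) =
  cfg (encq (inr (inord x.1, None))) (size x.2).-1 (marked x.2).
Proof.
case: w => // c w ltpc _ x.
rewrite [2 * _](_ : _ = (size w).+2 + size w); last by rewrite /=; lia.
rewrite iterD; have := run_back c w [::] ltpc; rewrite cats0 => ->.
rewrite iterS iterSr.
have -> : cfg (encq (inr (pc, None))) 0 (marked (c :: w)) =
  cfg (encq (inr (pc, None))) (@size 'I_#|{: tm_sym}|.+3 [::])
   ([::] ++ encs (true, c) :: [seq encs (false, c) | c <- w]) by [].
rewrite (@step_on _ (encq (inr (pc, Some (trans_at pc false c).1))) _ _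
  (encs (true, (trans_at pc false c).2)) _ true); last first.
  by rewrite /tm_of_delta encqK encsK ltpc.
have := run_sweep pc (trans_at pc false c).1 w
  [:: encs (true, (trans_at pc false c).2)].
move=> /= ->.
rewrite add1n.
set v := _ :: _.
have -> : (size w).+1 = size v by rewrite /v /= size_map size_sweep.
rewrite (@step_end _ (encq (inr (inord x.1, None))) _); last first.
  by rewrite /tm_of_delta encqK decs0 /x /sweep_step /= ltpc.
have -> : x.2 = (trans_at pc false c).2 ::
  (sweep (trans_at pc) (trans_at pc false c).1 w).2.
  by rewrite /x /sweep_step /= ltpc.
by rewrite /v /= size_map.
Qed.

Lemma run_unload c w post :
  iter (size w).+1 (@tm_step tm_of)
    (cfg (encq (inr (inord (size code), None))) (size w)
       (marked (c :: w) ++ post)) =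
  cfg (encq (inl true)) 0 ([seq bits (out c) | c <- c :: w] ++ post).
Proof.
elim/last_ind: w post => [|w d IH] post.
  rewrite iterSr /=.
  have -> : (cfg (encq (inr (inord (size code), None))) 0
      [:: encs (true, c) & post]) =
    (cfg (encq (inr (inord (size code), None)))
      (@size 'I_#|{: tm_sym}|.+3 [::]) ([::] ++ encs (true, c) :: post)) by [].
  rewrite (@step_on _ (encq (inl true)) _ _ (bits (out c)) _ false)//.
  by rewrite /tm_of_delta encqK encsK inordK // ltnn.
rewrite size_rcons iterSr /marked map_rcons -rcons_cons cat_rcons.
rewrite -[X in cfg _ X]/(size (c :: w)) -(size_marked (c :: w)).
rewrite (@step_on _ (encq (inr (inord (size code), None))) _ _ (bits (out d)) _
  false); last first.
  by rewrite /tm_of_delta encqK encsK inordK // ltnn.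
by rewrite size_marked IH -rcons_cons map_rcons cat_rcons.
Qed.

(** Once the counter equals [size code], [sweep_step] is the identity, so idle iterations cost no
    machine step. *)
Lemma run_code k pc w w' : pc <= size code -> 0 < size w ->
  iter k (sweep_step code) (pc, w) = (size code, w') ->
  exists2 t, t <= k * (2 * size w) &
  iter t (@tm_step tm_of)
    (cfg (encq (inr (inord pc, None))) (size w).-1 (marked w)) =
  cfg (encq (inr (inord (size code), None))) (size w').-1 (marked w').
Proof.
elim: k pc w => [|k IH] pc w lepc ltw.
  by move=> [-> ->]; exists 0.
rewrite iterSr; case: (ltnP pc (size code)) => [ltpc|gepc] E.
  have eqpc : (inord pc : 'I_(size code).+1) = pc :> nat by exact: inordK.
  have := @run_step (inord pc) w; rewrite /= eqpc => /(_ ltpc ltw) stp.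
  rewrite [sweep_step code (pc, w)]surjective_pairing in E.
  have [||t le_t Et] := IH _ _ _ _ E.
  - by rewrite /sweep_step ltpc geq_minr.
  - by rewrite /sweep_step ltpc size_sweep.
  exists (t + 2 * size w); last by rewrite iterD stp.
  by move: le_t; rewrite {1}/sweep_step ltpc size_sweep mulSn; lia.
have [|t le_t Et] := IH pc w lepc ltw.
  by move: E; rewrite /sweep_step ltnNge gepc.
by exists t => //; rewrite mulSn; lia.
Qed.

(** Without input there is no cell to mark, so this case stays outside the simulation; the blank
    tape reads as output 0. *)
Lemma tm_of_empty : halted (tm_init tm_of [::]).
Proof. by rewrite /halted /= /tm_of_delta decq0 /sym_blank decs0. Qed.

Lemma tm_of_correct (b : seq bool) k w' : 0 < size b ->
  iter k (sweep_step code) (0, [seq inp x | x <- b]) = (size code, w') ->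
  exists2 t, t <= (k + 1) * (2 * size b) + 1 &
    halted (tm_run (tm_init tm_of b) t) /\
    c_tape (tm_run (tm_init tm_of b) t) =
      nth ord0 [seq bits (out c) | c <- w'].
Proof.
move=> ltb E.
have [|t le_t Et] := run_code (leq0n _) _ E; first by rewrite size_map.
rewrite size_map in le_t Et.
have size_w' : size w' = size b.
  have size_iter i x : size (iter i (sweep_step code) x).2 = size x.2.
    elim: i => //= i <-; rewrite {1}/sweep_step; case: ifP => //= _.
    by rewrite size_sweep.
  by have := size_iter k (0, [seq inp x | x <- b]); rewrite E /= size_map.
(* From right to left in order of time: loading together with the turn at the blank, the sweeps, and
   unloading. *)
exists (size w' + (t + (size b).+1)).
  by rewrite size_w' mulnDl; lia.
suff -> : tm_run (tm_init tm_of b) (size w' + (t + (size b).+1)) =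
  cfg (encq (inl true)) 0 [seq bits (out c) | c <- w'].
  by split=> //; rewrite /halted /= /tm_of_delta encqK.
have -> : tm_init tm_of b = cfg ord0 0 [seq bits x | x <- b].
  rewrite /tm_init /cfg; congr (@Cfg tm_of).
  apply: functional_extensionality => p; case: ifP => lt.
    by rewrite (nth_map false).
  by rewrite nth_default // size_map leqNgt lt.
rewrite /tm_run iterD iterD.
case: b ltb size_w' E Et {le_t} => // x b _ size_w' E Et.
rewrite iterS iterSr.
have -> : cfg ord0 0 [seq bits x | x <- x :: b] =
  cfg ord0 (@size 'I_#|{: tm_sym}|.+3 [::])
    ([::] ++ bits x :: [seq bits x | x <- b]) by [].
rewrite (@step_on _ (encq (inl false)) _ _ (encs (true, inp x)) _ true);
  last by rewrite /tm_of_delta decq0 bitsK.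
rewrite [size [::]]/= (run_load b [:: encs (true, inp x)]).
set v := _ ++ _.
have -> : size [:: encs (true, inp x)] + size b = size v.
  by rewrite /v size_cat size_map.
rewrite (@step_end _ (encq (inr (ord0, None))) v); last first.
  by rewrite /tm_of_delta encqK decs0.
have -> : ord0 = inord 0 :> 'I_(size code).+1.
  by apply: val_inj; rewrite /= inordK.
have -> : v = marked [seq inp x | x <- x :: b].
  by rewrite /v /= -map_comp.
have -> : (size (marked [seq inp x | x <- x :: b])).-1 = (size (x :: b)).-1.
  by rewrite size_marked size_map.
rewrite Et.
case: w' size_w' {E Et} => // c w' _.
by have := run_unload c w' [::]; rewrite !cats0.
Qed.
End SweepMachine.

(** * Programs over bit tracks *)

Inductive bexp :=
  | BTrue | BVar of nat | BNot of bexp | BAnd of bexp & bexp.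

Fixpoint evalb (b : bexp) (f : nat -> bool) : bool :=
  match b with
  | BTrue => true
  | BVar t => f t
  | BNot b => ~~ evalb b f
  | BAnd b1 b2 => evalb b1 f && evalb b2 f
  end.

Fixpoint bexp_lt K (b : bexp) : bool :=
  match b with
  | BTrue => true
  | BVar t => t < K
  | BNot b => bexp_lt K b
  | BAnd b1 b2 => bexp_lt K b1 && bexp_lt K b2
  end.

Inductive prog :=
  | Skip
  | Assign of nat & bexp
  | Shift of nat & bool
  | Seq of prog & prog
  | If of bexp & prog & prog
  | For of nat & prog.

Definition store := nat -> nat -> bool.

Definition upd (s : store) t (f : nat -> bool) : store :=
  fun u => if u == t then f else s u.

Definition some_cell L b (s : store) := has (fun i => evalb b (s^~ i)) (iota 0 L).

(* Inside [For r p] the track [r] is one-hot at the current position; on exit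
   the marker has been shifted past the last cell. *)
Fixpoint den L (p : prog) (s : store) : store :=
  match p with
  | Skip => s
  | Assign t b => upd s t (fun i => evalb b (s^~ i))
  | Shift t b => upd s t (fun i => if i is j.+1 then s t j else b)
  | Seq p q => den L q (den L p s)
  | If b p q => if some_cell L b s then den L p s else den L q s
  | For r p =>
      upd (foldl (fun s i => den L p (upd s r (pred1 i))) s (iota 0 L))
        r (pred1 L)
  end.

Fixpoint writes (p : prog) : seq nat :=
  match p with
  | Skip => [::]
  | Assign t _ => [:: t]
  | Shift t _ => [:: t]
  | Seq p q => writes p ++ writes q
  | If _ p q => writes p ++ writes q
  | For r p => r :: writes p
  end.

(** The track of a loop is its only counter, hence the ban on writing it in the body. *)
Fixpoint wf K (p : prog) : bool :=
  match p with
  | Skip => true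
  | Assign t b => (t < K) && bexp_lt K b
  | Shift t _ => t < K
  | Seq p q => wf K p && wf K q
  | If b p q => [&& bexp_lt K b, wf K p & wf K q]
  | For r p => [&& r < K, r \notin writes p & wf K p]
  end.

Lemma den_frame L p s t : t \notin writes p -> den L p s t = s t.
Proof.
elim: p s => //= [u b|u b|p IHp q IHq|b p IHp q IHq|r p IHp] s.
- by rewrite inE /upd => /negPf ->.
- by rewrite inE /upd => /negPf ->.
- by rewrite mem_cat negb_or => /andP[Hp Hq]; rewrite IHq // IHp.
- by rewrite mem_cat negb_or => /andP[Hp Hq]; case: ifP => _; auto.
- rewrite inE negb_or => /andP[ntr Hp]; rewrite {1}/upd (negPf ntr).
  elim: (iota 0 L) s => //= i l IH s.
  by rewrite IH IHp // /upd (negPf ntr).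
Qed.

(** Bounds the number of sweeps of the compiled program independently of the store; [If] is
    therefore charged for both branches. *)
Fixpoint cost L (p : prog) : nat :=
  match p with
  | Skip => 0
  | Assign _ _ => 1
  | Shift _ _ => 1
  | Seq p q => cost L p + cost L q
  | If _ p q => 2 + (cost L p + cost L q)
  | For _ p => 2 + L * (cost L p + 1)
  end.

Lemma cost_poly p : exists c d, forall L, cost L p <= c * L.+1 ^ d.
Proof.
elim: p => [|t b|t b|p [c1 [d1 IH1]] q [c2 [d2 IH2]]
  |b p [c1 [d1 IH1]] q [c2 [d2 IH2]]|r p [c [d IH]]].
- by exists 0, 0.
- by exists 1, 0.
- by exists 1, 0.
(* The sum of the degrees replaces their maximum: both powers are positive, so multiplying a term by
   the other power does not decrease it. *)
- exists (c1 + c2), (d1 + d2) => L /=; rewrite expnD.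
  have := IH1 L; have := IH2 L.
  have : 0 < L.+1 ^ d1 by rewrite expn_gt0.
  have : 0 < L.+1 ^ d2 by rewrite expn_gt0.
  nia.
- exists (2 + (c1 + c2)), (d1 + d2) => L /=; rewrite expnD.
  have := IH1 L; have := IH2 L.
  have : 0 < L.+1 ^ d1 by rewrite expn_gt0.
  have : 0 < L.+1 ^ d2 by rewrite expn_gt0.
  nia.
- exists (c + 3), d.+1 => L /=; rewrite expnS.
  have := IH L; have : 0 < L.+1 ^ d by rewrite expn_gt0.
  nia.
Qed.

(** * Compilation of programs to sweep code *)

Section Compile.
Variable K : nat.

Definition cell := {ffun 'I_K -> bool}.

Definition getc (c : cell) t := if insub t is Some i then c i else false.
Definition evalc b (c : cell) := evalb b (getc c).
Definition updc (c : cell) t v : cell :=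
  [ffun i : 'I_K => if val i == t then v else c i].
Definition cell_at (s : store) p : cell := [ffun i : 'I_K => s i p].
Definition tape_of L (s : store) := mkseq (cell_at s) L.

Lemma getc_at s p t : t < K -> getc (cell_at s p) t = s t p.
Proof. by move=> lt; rewrite /getc insubT ffunE. Qed.

Lemma evalc_at b s p : bexp_lt K b -> evalc b (cell_at s p) = evalb b (s^~ p).
Proof.
rewrite /evalc; elim: b => //= [t lt|b IH lt|b IHb c IHc /andP[/IHb -> /IHc ->]] //.
- exact: getc_at.
- by rewrite IH.
Qed.

Lemma updc_at s p t v f : f p = v ->
  updc (cell_at s p) t v = cell_at (upd s t f) p.
Proof.
by move=> <-; apply/ffunP => i; rewrite !ffunE /upd; case: ifP.
Qed.

Definition assign_instr t b next : instr cell :=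
  Instr (fun s c => (s, updc c t (evalc b c))) (fun=> next).
(* The carry is stored xor-ed with the fill bit, as sweeps start with carry
   [false]. *)
Definition shift_instr t b next : instr cell :=
  Instr (fun s c => (b (+) getc c t, updc c t (b (+) s))) next.
Definition test_instr b next1 next0 : instr cell :=
  Instr (fun s c => (s || evalc b c, c)) (fun s => if s then next1 else next0).

Fixpoint code_size (p : prog) : nat :=
  match p with
  | Skip => 0
  | Assign _ _ => 1
  | Shift _ _ => 1
  | Seq p q => code_size p + code_size q
  | If _ p q => (code_size p + code_size q).+2
  | For _ p => (code_size p).+3
  end.

(** Jump targets are absolute, hence [base]. A test of [BTrue] with equal targets is an
    unconditional jump. A loop ends when the closing shift pushes the marker off the last cell,
    which its final carry reports. *)
Fixpoint compile (p : prog) (base : nat) : seq (instr cell) :=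
  match p with
  | Skip => [::]
  | Assign t b => [:: assign_instr t b base.+1]
  | Shift t b => [:: shift_instr t b (fun=> base.+1)]
  | Seq p q => compile p base ++ compile q (base + code_size p)
  | If b p q =>
      let mid := (base + code_size p).+2 in
      let last := mid + code_size q in
      test_instr b base.+1 mid :: compile p base.+1 ++
        test_instr BTrue last last :: compile q mid
  | For r p =>
      assign_instr r (BNot BTrue) base.+1 ::
      shift_instr r true (fun=> base.+2) :: rcons (compile p base.+2)
      (shift_instr r false
         (fun s => if s then (base + code_size p).+3 else base.+2))
  end.

Lemma size_compile p base : size (compile p base) = code_size p.
Proof.
elim: p base => //= [p IHp q IHq|b p IHp q IHq|r p IH] base.
- by rewrite size_cat IHp IHq.
- by rewrite size_cat /= IHp IHq addnS.
- by rewrite size_rcons IH.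
Qed.

Lemma sweep_assign t b next z (w : seq cell) :
  sweep (i_trans (assign_instr t b next)) z w =
  (z, [seq updc c t (evalc b c) | c <- w]).
Proof. by elim: w z => //= c w IH z; rewrite IH. Qed.

Lemma sweep_test b n1 n0 z (w : seq cell) :
  sweep (i_trans (test_instr b n1 n0)) z w = (z || has (evalc b) w, w).
Proof.
elim: w z => [|c w IH] z /=; first by rewrite orbF.
by rewrite IH orbA.
Qed.

(** [f] is the shifted track, and the carry entering cell [m] encodes [f m]. Since [f 0 = b], it is
    [false] at the left end, as every sweep requires. *)
Lemma sweep_shift t b next s m L : t < K ->
  let f i := if i is j.+1 then s t j else b in
  sweep (i_trans (shift_instr t b next)) (b (+) f m)
    [seq cell_at s i | i <- iota m L] =
  (b (+) f (m + L), [seq cell_at (upd s t f) i | i <- iota m L]).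
Proof.
move=> lt f; elim: L m => [|L IH] m; first by rewrite addn0.
rewrite [iota _ _]/= !map_cons /= -[RHS]/(_, _ :: _).
have := IH m.+1; rewrite [f m.+1]/= => IHm.
rewrite getc_at // IHm -addSnnS; congr (_, _ :: _).
by apply: updc_at; rewrite addbA addbb.
Qed.

Lemma sweep_step_at pre (i : instr cell) post w :
  sweep_step (pre ++ i :: post) (size pre, w) =
  (minn (i_next i (sweep (i_trans i) false w).1) (size (pre ++ i :: post)),
   (sweep (i_trans i) false w).2).
Proof.
rewrite /sweep_step /= {1}size_cat /= -{1}[size pre]addn0 ltn_add2l /=.
by rewrite nth_cat ltnn subnn.
Qed.

Lemma step_assign pre t b post L s : t < K -> bexp_lt K b ->
  sweep_step (pre ++ assign_instr t b (size pre).+1 :: post)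
    (size pre, tape_of L s) =
  ((size pre).+1, tape_of L (den L (Assign t b) s)).
Proof.
move=> ltt ltb; rewrite sweep_step_at sweep_assign size_cat /=; congr (_, _).
  by apply/minn_idPl; lia.
rewrite /tape_of /mkseq -map_comp; apply: eq_map => i /=.
by apply: updc_at; rewrite evalc_at.
Qed.

Lemma step_shift pre t b next post L s : t < K ->
  (forall z, next z <= size (pre ++ shift_instr t b next :: post)) ->
  sweep_step (pre ++ shift_instr t b next :: post) (size pre, tape_of L.+1 s) =
  (next (b (+) s t L), tape_of L.+1 (den L.+1 (Shift t b) s)).
Proof.
move=> lt le; rewrite sweep_step_at /tape_of /mkseq.
have := sweep_shift b next s 0 L.+1 lt.
cbv beta iota zeta; rewrite addbb add0n => ->.
by congr (_, _); apply/minn_idPl.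
Qed.

Lemma step_test pre b n1 n0 post L s : bexp_lt K b ->
  n1 <= size (pre ++ test_instr b n1 n0 :: post) ->
  n0 <= size (pre ++ test_instr b n1 n0 :: post) ->
  sweep_step (pre ++ test_instr b n1 n0 :: post) (size pre, tape_of L s) =
  (if some_cell L b s then n1 else n0, tape_of L s).
Proof.
move=> ltb le1 le0; rewrite sweep_step_at sweep_test /=.
have -> : has (evalc b) (tape_of L s) = some_cell L b s.
  rewrite /tape_of /mkseq has_map /some_cell; apply: eq_has => i /=.
  by rewrite evalc_at.
by congr (_, _); apply/minn_idPl; case: ifP.
Qed.

Lemma compile_correct p L s pre post : wf K p -> 0 < L ->
  exists2 k, k <= cost L p &
    iter k (sweep_step (pre ++ compile p (size pre) ++ post))
      (size pre, tape_of L s) =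
    (size pre + code_size p, tape_of L (den L p s)).
Proof.
move=> + L0; elim: p s pre post =>
  [|t b|t b|p IHp q IHq|b p IHp q IHq|r p IHp] s pre post.
- by exists 0; rewrite //= addn0.
- move=> /= /andP[ltt ltb]; exists 1 => //.
  by rewrite [iter _ _ _]/= step_assign // addn1.
- move=> /= ltt; exists 1 => //.
  case: L L0 => // L _.
  rewrite [iter _ _ _]/= step_shift ?addn1 // => z.
  by rewrite size_cat /=; lia.
- move=> /= /andP[/IHp{}IHp /IHq{}IHq].
  have [k1 le1 E1] := IHp s pre (compile q (size pre + code_size p) ++ post).
  have [k2 le2 E2] := IHq (den L p s) (pre ++ compile p (size pre)) post.
  exists (k2 + k1); first by rewrite addnC leq_add.
  rewrite iterD -catA E1.
  by move: E2; rewrite size_cat size_compile -catA => ->; rewrite addnA.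
- move=> /= /and3P[ltb /IHp{}IHp /IHq{}IHq].
  set mid := (_ + _).+2; set last := mid + _.
  set i1 := test_instr b _ _; set i2 := test_instr BTrue _ _.
  have [k1 le1 E1] := IHp s (rcons pre i1)
    (i2 :: compile q mid ++ post).
  have [k2 le2 E2] := IHq s
    ((rcons pre i1) ++ rcons (compile p (size pre).+1) i2) post.
  set code := _ ++ _.
  have step1 : sweep_step code (size pre, tape_of L s) =
    (if some_cell L b s then (size pre).+1 else mid, tape_of L s).
    rewrite /code /= /i1 step_test //= !size_cat /= !size_cat /= !size_compile;
      rewrite /mid; lia.
  rewrite size_rcons cat_rcons in E1.
  rewrite !size_cat !size_rcons !size_compile -!catA !cat_rcons in E2.
  have midE : (size pre).+1 + (code_size p).+1 = mid by rewrite /mid; lia.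
  rewrite midE in E2.
  have codeE : pre ++ i1 :: compile p (size pre).+1 ++ i2 :: compile q mid ++
    post = code by rewrite /code /= -catA.
  have lastE : size pre + (code_size p + code_size q).+2 = last.
    by rewrite /last /mid; lia.
  rewrite codeE in E1 E2; rewrite lastE.
  case: ifP => c; rewrite c in step1.
    exists (k1.+2); first by rewrite /=; lia.
    rewrite iterS iterSr step1 E1.
    have szE : (size pre).+1 + code_size p =
      size (pre ++ i1 :: compile p (size pre).+1).
      by rewrite size_cat /= size_compile; lia.
    have codeE' : code = (pre ++ i1 :: compile p (size pre).+1) ++
       i2 :: compile q mid ++ post by rewrite -codeE -catA.
    rewrite szE codeE' step_test //.
    + by case: ifP.
    + by rewrite !size_cat /= size_cat !size_compile /last /mid; lia.
    + by rewrite !size_cat /= size_cat !size_compile /last /mid; lia.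
  exists (k2.+1); first by rewrite /=; lia.
  by rewrite iterSr step1 E2.
- move=> /= /and3P[ltr nw /IHp{}IHp].
  set i1 := assign_instr _ _ _; set i2 := shift_instr _ _ _.
  set i3 := shift_instr _ _ _; set code := _ ++ _.
  have codeE : code = rcons (rcons pre i1) i2 ++ compile p (size pre).+2 ++
    i3 :: post by rewrite /code !cat_rcons.
  have step1 s0 : sweep_step code (size pre, tape_of L s0) =
      ((size pre).+1, tape_of L (den L (Assign r (BNot BTrue)) s0)).
    by rewrite /code /i1 /= step_assign.
  have step2 s0 : sweep_step code ((size pre).+1, tape_of L s0) =
      ((size pre).+2, tape_of L (den L (Shift r true) s0)).
    rewrite codeE cat_rcons /i2; case: (L) L0 => // L' _.
    rewrite -(size_rcons pre i1) step_shift // => z.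
    by rewrite size_cat /= size_rcons; lia.
  pose F := fun s i => den L p (upd s r (pred1 i)).
  have Fr s0 i : F s0 i r = pred1 i by rewrite /F den_frame // /upd eqxx.
  have step3 s0 : sweep_step code ((size pre).+2 + code_size p, tape_of L s0) =
      (if s0 r L.-1 then (size pre + code_size p).+3 else (size pre).+2,
       tape_of L (den L (Shift r false) s0)).
    rewrite codeE catA /i3; case: (L) L0 => // L' _.
    have szE : (size pre).+2 + code_size p =
        size (rcons (rcons pre i1) i2 ++ compile p (size pre).+2).
      by rewrite size_cat !size_rcons size_compile.
    rewrite szE step_shift // => z.
    rewrite size_cat /= -szE; case: ifP; lia.
  (* The body is entered with the marker on cell [m] and [l.+1] rounds to go. By [Fr] the body
     leaves the marker in place, so the closing shift moves it to [m.+1] or, in the last round, off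
     the tape. *)
  have loop m l s0 : m + l.+1 = L ->
    exists2 k, k <= l.+1 * (cost L p + 1) &
    iter k (sweep_step code)
      ((size pre).+2, tape_of L (upd s0 r (pred1 m))) =
    (size pre + (code_size p).+3,
      tape_of L (upd (foldl F s0 (iota m l.+1)) r (pred1 L))).
    elim: l m s0 => [|l IHl] m s0 mL.
      have [k le E] := IHp (upd s0 r (pred1 m)) (rcons (rcons pre i1) i2)
        (i3 :: post).
      exists k.+1; first by lia.
      rewrite !size_rcons -codeE in E; rewrite iterS E step3.
      rewrite -/(F s0 m) Fr /=.
      have -> : L.-1 == m by lia.
      rewrite !addnS; congr (_, _); apply: eq_map => i.
      congr cell_at; rewrite /upd; apply: functional_extensionality => u.
      case: eqP => // _; rewrite -/(F s0 m) Fr.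
      by apply: functional_extensionality => -[|j] /=; lia.
    have [k1 le1 E1] := IHl m.+1 (F s0 m) ltac:(lia).
    have [k le E] := IHp (upd s0 r (pred1 m)) (rcons (rcons pre i1) i2)
      (i3 :: post).
    exists (k1 + k.+1); first by lia.
    rewrite !size_rcons -codeE in E; rewrite iterD iterS E step3.
    rewrite -/(F s0 m) Fr /=.
    have -> : (L.-1 == m) = false by lia.
    rewrite -[RHS]E1; congr (iter _ _ (_, _)); apply: eq_map => i.
    congr cell_at; rewrite /upd; apply: functional_extensionality => u.
    case: eqP => // _; rewrite -/(F s0 m) Fr.
    by apply: functional_extensionality => -[|j] /=; lia.
  have [|k le E] := loop 0 L.-1 s; first by lia.
  exists (k.+2); first by move: le; rewrite prednK //; lia.
  rewrite !iterSr step1 step2.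
  move: E; rewrite prednK // -/F => <-.
  congr (iter _ _ (_, _)); apply: eq_map => i.
  congr cell_at; apply: functional_extensionality => u.
  rewrite /= /upd; case: eqP => // _.
  by apply: functional_extensionality => -[|j]; rewrite /= ?eqxx.
Qed.

End Compile.

(** * First-order queries *)

(* Tracks are numbered in three disjoint families: flags 3k, vertex variables
   3k+1, and named tracks 3k+2. *)
Definition flag d := 3 * d.
Definition var x := (3 * x).+1.
Definition t_graph := 2.
Definition t_last := 5.
Definition t_alive := 8.
Definition t_sated := 11.
Definition t_needy := 14.
Definition t_out := 17.
Definition t_row := 20.
Definition t_col := 23.
Definition t_pos := 26.
Definition t_count := 29.

Definition persistent :=
  [:: t_graph; t_last; t_alive; t_sated; t_needy; t_out].

Ltac track_neq :=
  rewrite /flag /var /t_graph /t_last /t_alive /t_sated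
  /t_needy /t_out /t_row /t_col /t_pos /t_count; lia.

Inductive formula :=
  | FIn of nat & nat
  | FEq of nat & nat
  | FAdj of nat & nat
  | FNot of formula
  | FAnd of formula & formula
  | FEx of nat & formula.

Definition BOr b c := BNot (BAnd (BNot b) (BNot c)).

Definition init r := Seq (Assign r (BNot BTrue)) (Shift r true).

(* Advances the pair (t_row, t_col) of a position in a matrix whose last column
   is marked on [t]. *)
Definition odometer t :=
  If (BAnd (BVar t_col) (BVar t)) (Seq (init t_col) (Shift t_row false))
    (Shift t_col false).

(** An entry of the matrix cannot be addressed, so all positions are visited while row and column
    are counted along. The three tests look at three different cells and hence cannot be merged into
    one [BAnd]. *)
Definition eval_adj f x y :=
  Seq (Assign f (BNot BTrue)) (Seq (init t_row) (Seq (init t_col)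
   (For t_pos (Seq
     (If (BAnd (BVar t_row) (BVar (var x)))
       (If (BAnd (BVar t_col) (BVar (var y)))
         (If (BAnd (BVar t_pos) (BVar t_graph)) (Assign f BTrue) Skip) Skip)
       Skip)
     (odometer t_last))))).

Definition eval_test f b :=
  If b (Assign f BTrue) (Assign f (BNot BTrue)).

(* The truth value ends up in all cells of the track [flag d]. *)
Fixpoint eval d (phi : formula) : prog :=
  match phi with
  | FIn t x => eval_test (flag d) (BAnd (BVar (var x)) (BVar t))
  | FEq x y => eval_test (flag d) (BAnd (BVar (var x)) (BVar (var y)))
  | FAdj x y => eval_adj (flag d) x y
  | FNot phi => Seq (eval d phi) (Assign (flag d) (BNot (BVar (flag d))))
  | FAnd phi psi => Seq (eval d phi) (Seq (eval d.+1 psi)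
      (Assign (flag d) (BAnd (BVar (flag d)) (BVar (flag d.+1)))))
  | FEx x phi => Seq (Assign (flag d) (BNot BTrue)) (For (var x)
      (Seq (eval d.+1 phi)
        (Assign (flag d) (BOr (BVar (flag d)) (BVar (flag d.+1))))))
  end.

Fixpoint scoped (D : seq nat) (phi : formula) : bool :=
  match phi with
  | FIn t x => (t \in persistent) && (x \in D)
  | FEq x y => (x \in D) && (y \in D)
  | FAdj x y => (x \in D) && (y \in D)
  | FNot phi => scoped D phi
  | FAnd phi psi => scoped D phi && scoped D psi
  | FEx x phi => (x \notin D) && scoped (x :: D) phi
  end.

(** The tracks that a query at depth [d] with the variables [D] in scope leaves alone. Its result
    goes to flag [d]; higher flags, bound variables and the odometer are scratch space. *)
Definition keeps (D : seq nat) d t :=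
  [|| t \in persistent, (t %% 3 == 0) && (t < flag d) |
  (t %% 3 == 1) && (t %/ 3 \in D)].

Lemma persistent_mod t : t \in persistent -> t %% 3 = 2.
Proof. by rewrite !inE => /or4P[||| /or3P[]] /eqP ->. Qed.

Lemma keeps_flag D d k : keeps D d (flag k) = (k < d).
Proof.
rewrite /keeps /flag modnMr ltn_pmul2l //= orbF.
by case: (boolP (_ \in _)) => // /persistent_mod; rewrite modnMr.
Qed.

Lemma keeps_var D d x : keeps D d (var x) = (x \in D).
Proof.
have m : (var x) %% 3 = 1 by rewrite /var; lia.
have q : (var x) %/ 3 = x by rewrite /var; lia.
rewrite /keeps m q /=.
by case: (boolP (var x \in _)) => // /persistent_mod; rewrite m.
Qed.

Lemma keeps_S D d t : keeps D d t -> keeps D d.+1 t.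
Proof.
rewrite /keeps /flag; case/or3P => [->//|/andP[-> lt]|->]; rewrite ?orbT //.
by rewrite (leq_trans lt) ?orbT // leq_pmul2l.
Qed.

Lemma keeps_cons D d t x : keeps D d t -> keeps (x :: D) d t.
Proof.
rewrite /keeps [t %/ 3 \in _ :: _]inE.
by case/or3P => [->//|->|/andP[-> ->]]; rewrite ?orbT.
Qed.

Lemma eval_writes phi D d : scoped D phi ->
  all (fun t => ~~ keeps D d t) (writes (eval d phi)).
Proof.
have nf E k : keeps E k (flag k) = false by rewrite keeps_flag ltnn.
elim: phi D d => /= [t x|x y|x y|phi IH|phi IHp psi IHq|x phi IH] D d.
- by rewrite nf.
- by rewrite nf.
- by move=> _; rewrite nf /= /keeps.
- by move=> c; rewrite all_cat IH //= nf.
- case/andP=> cp cq; rewrite !all_cat IHp //= nf /= andbT.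
  apply: (sub_all (a1 := fun t => ~~ keeps D d.+1 t)); last exact: IHq.
  by move=> t; apply: contra; apply: keeps_S.
- case/andP=> nx c; rewrite nf keeps_var nx /= all_cat /= nf /= andbT.
  apply: (sub_all (a1 := fun t => ~~ keeps (x :: D) d.+1 t)); last exact: IH.
  by move=> t; apply: contra => k; apply: keeps_S; apply: keeps_cons.
Qed.

Lemma eval_frame L phi D d s t : scoped D phi -> keeps D d t ->
  den L (eval d phi) s t = s t.
Proof.
move=> c k; apply: den_frame; apply: contraL k => w.
exact: (allP (eval_writes d c)).
Qed.

Lemma updE s t f : upd s t f t = f.
Proof. by rewrite /upd eqxx. Qed.

Lemma updN s t f u : u != t -> upd s t f u = s u.
Proof. by rewrite /upd => /negPf ->. Qed.

Lemma den_seq L p q s : den L (Seq p q) s = den L q (den L p s).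
Proof. by []. Qed.

Lemma den_init L r s : den L (init r) s r =1 pred1 0.
Proof.
by move=> [|i]; rewrite /= /upd eqxx.
Qed.

Lemma den_init_other L r s t : t != r -> den L (init r) s t = s t.
Proof. by move=> ne; rewrite /= !updN. Qed.

(** A one-hot track is a pointer, and this test dereferences it. *)
Lemma some_marked L s a b i : s a =1 pred1 i -> i < L ->
  some_cell L (BAnd (BVar a) (BVar b)) s = s b i.
Proof.
move=> sa lt; apply/hasP/idP => [[j _ /= /andP[]]|sb].
  by rewrite sa => /eqP ->.
by exists i; rewrite ?mem_iota //= sa /= eqxx.
Qed.

Lemma some_flag L s a b : 0 < L -> (forall p, s a p = b) ->
  some_cell L (BVar a) s = b.
Proof.
move=> lt sa; apply/hasP/idP => [[j _ /=]|sb]; first by rewrite sa.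
by exists 0; rewrite ?mem_iota //= sa.
Qed.

Lemma den_for (I : nat -> store -> Prop) L r p s : I 0 s ->
  (forall m s, m < L -> I m s -> I m.+1 (den L p (upd s r (pred1 m)))) ->
  exists2 s', I L s' & den L (For r p) s = upd s' r (pred1 L).
Proof.
move=> I0 IS /=; eexists; last by [].
suff H m : m <= L ->
    I m (foldl (fun s i => den L p (upd s r (pred1 i))) s (iota 0 m)).
  exact: H.
elim: m => // m IH lt; rewrite -addn1 iotaD foldl_cat /= add0n addn1.
by apply: IS => //; apply: IH; apply: ltnW.
Qed.

(** The column wraps exactly when [k] divides [m.+1], which is when the quotient grows. The bound
    [k <= L] keeps the last column within the cells that the test sees. *)
Lemma odometerP L s t k m : s t_row =1 pred1 (m %/ k) -> s t_col =1 pred1 (m %% k) ->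
  s t =1 pred1 k.-1 -> 0 < k <= L ->
  den L (odometer t) s t_row =1 pred1 (m.+1 %/ k) /\
  den L (odometer t) s t_col =1 pred1 (m.+1 %% k).
Proof.
move=> row col last /andP[k0 kL].
have mk := ltn_pmod m k0.
rewrite [den _ _ _]/= (some_marked _ col (leq_trans mk kL)) last /=.
have shift f j : f =1 pred1 j ->
    (fun i => if i is i'.+1 then f i' else false) =1 pred1 j.+1.
  by move=> fj [|i] //=; rewrite fj.
have dvd : (m %% k == k.-1) = (k %| m.+1).
  rewrite /dvdn modnS; case: ifP => [|nd]; rewrite ?eqxx.
    rewrite /dvdn -addn1 -modnDml => /eqP.
    case: (eqVneq (m %% k) k.-1) => // ne; rewrite modn_small; lia.
  have := nd; rewrite /dvdn modnS nd => ->.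
  apply/negP => /eqP E; move/negP: nd; apply.
  by rewrite {1}(divn_eq m k) E -addnS prednK // dvdn_addr ?dvdn_mull.
rewrite divnS // modnS -dvd; case: eqP => E; split.
- by rewrite /= updE add1n; apply: shift => i; rewrite updN // updN.
- by rewrite updN //; apply: den_init.
- by rewrite updN.
- by rewrite updE; apply: shift.
Qed.

(** * Semantics of queries *)

Section Semantics.
Variables (L n : nat).
Hypotheses (n_gt0 : 0 < n) (LE : L = n * n).

Definition bind (rho : nat -> nat) x i := fun y => if y == x then i else rho y.

(** Quantifiers range over all tape positions, not only over vertices. Hence the bounds in the
    clause of [FAdj]: a column index of [n] or more would run into a later row. *)
Fixpoint holds (s : store) (rho : nat -> nat) (phi : formula) : bool :=
  match phi with
  | FIn t x => s t (rho x)
  | FEq x y => rho x == rho y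
  | FAdj x y => [&& rho x < n, rho y < n & s t_graph (rho x * n + rho y)]
  | FNot phi => ~~ holds s rho phi
  | FAnd phi psi => holds s rho phi && holds s rho psi
  | FEx x phi => has (fun i => holds s (bind rho x i) phi) (iota 0 L)
  end.

Lemma eq_holds s s' rho phi D : scoped D phi ->
  {in persistent, forall t, s t = s' t} -> holds s rho phi = holds s' rho phi.
Proof.
move=> + ss'; elim: phi rho D => /=
  [t x|x y|x y|phi IH|phi IHp psi IHq|x phi IH] rho D //.
- by case/andP=> tp _; rewrite ss'.
- by rewrite ss'.
- by move=> c; rewrite (IH _ D).
- by case/andP=> ? ?; rewrite (IHp _ D) // (IHq _ D).
- by case/andP=> _ c; apply: eq_has => i; rewrite (IH _ (x :: D)).
Qed.

Definition assigns (s : store) (D : seq nat) (rho : nat -> nat) :=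
  {in D, forall x, s (var x) =1 pred1 (rho x) /\ rho x < L}.

Lemma eval_testP d b s p :
  den L (eval_test (flag d) b) s (flag d) p = some_cell L b s.
Proof. by rewrite /=; case: ifP => c; rewrite updE. Qed.

Lemma eval_adjP d s x y i j : s (var x) =1 pred1 i -> s (var y) =1 pred1 j ->
  s t_last =1 pred1 n.-1 -> i < L -> j < L ->
  forall p, den L (eval_adj (flag d) x y) s (flag d) p =
    [&& i < n, j < n & s t_graph (i * n + j)].
Proof.
move=> sx sy last iL jL p.
have nL : n <= L by rewrite LE leq_pmull.
have fl : forall t, t %% 3 != 0 -> t == flag d = false.
  by move=> t; apply: contraNF => /eqP ->; rewrite /flag modnMr.
have fl' : forall t, t %% 3 != 0 -> flag d == t = false.
  by move=> t nt; rewrite eq_sym fl.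
have vr t x0 : t %% 3 != 1 -> var x0 == t = false.
  by apply: contraNF => /eqP <-; rewrite /var; lia.
(* [F m]: the entry sought lies among the first [m] positions and is a 1. *)
pose F m := has (fun q => [&& q %/ n == i, q %% n == j & s t_graph q]) (iota 0 m).
pose I m (s' : store) := [/\ s' t_row =1 pred1 (m %/ n), s' t_col =1 pred1 (m %% n),
  (forall q, s' (flag d) q = F m) &
  {in [:: var x; var y; t_last; t_graph], forall t, s' t = s t}].
rewrite /eval_adj 3!den_seq.
set s0 := den L (init t_col) _.
set body := Seq _ _.
have [||s' [_ _ Fs' _] ->] := @den_for I L t_pos body s0.
- split.
  + by move=> q; rewrite div0n /s0 den_init_other // den_init.
  + by move=> q; rewrite mod0n /s0 den_init.
  + by move=> q; rewrite /s0 !den_init_other ?fl' //= updE.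
  + move=> t tin; rewrite /s0.
    have [t1 t2 t3] : [/\ t != t_row, t != t_col & t != flag d].
      by move: tin; rewrite !inE => /or4P[] /eqP ->; split; track_neq.
    by rewrite !den_init_other //= updN.
- move=> m s1 mL [row col fs1 same].
  set s2 := upd s1 _ _; rewrite /body den_seq.
  set s3 := den L (If _ _ _) s2.
  have s3E t : t != flag d -> s3 t = s2 t.
    by move=> nt; rewrite /s3; cbn [den]; do 3!case: ifP => // _; rewrite updN.
  have row2 : s2 t_row =1 pred1 (m %/ n) by [].
  have col2 : s2 t_col =1 pred1 (m %% n) by [].
  have pos2 : s2 t_pos =1 pred1 m by [].
  have varN z : t_pos == var z = false by rewrite eq_sym vr.
  have same2 t : t \in [:: var x; var y; t_last; t_graph] -> s2 t = s t.
    move=> tin; rewrite /s2 updN ?same //.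
    by move: tin; rewrite !inE => /or4P[] /eqP -> //; rewrite vr.
  have f3 q : s3 (flag d) q = F m.+1.
    rewrite /F -addn1 iotaD has_cat /= add0n orbF -/(F m) /s3; cbn [den].
    have lt1 : m %/ n < L by apply: leq_ltn_trans mL; apply: leq_div.
    have lt2 : m %% n < L by apply: leq_trans nL; apply: ltn_pmod.
    rewrite (some_marked _ row2 lt1) (some_marked _ col2 lt2)
      (some_marked _ pos2 mL).
    rewrite !same2 ?inE ?eqxx ?orbT // sx sy /=.
    have f2 : s2 (flag d) q = F m by rewrite /s2 updN ?fl'.
    case: eqP => _ /=; last by rewrite orbF.
    case: eqP => _ /=; last by rewrite orbF.
    by case: ifP => _ /=; rewrite ?updE ?orbT // orbF.
  have [||||row' col'] := @odometerP L s3 t_last n m.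
  + by move=> q; rewrite s3E ?fl //.
  + by move=> q; rewrite s3E ?fl //.
  + by move=> q; rewrite s3E ?fl // same2 // !inE eqxx !orbT.
  + by rewrite n_gt0.
  split=> //.
  + by move=> q; rewrite den_frame //= !inE !fl'.
  + move=> t tin.
    have [t1 t2 t3] : [/\ t != t_row, t != t_col & t != flag d].
      by move: tin; rewrite !inE => /or4P[] /eqP ->; split; track_neq.
    rewrite den_frame ?s3E ?same2 //.
    by rewrite /= !inE (negPf t1) (negPf t2).
rewrite updN ?fl' // Fs' /F.
apply/hasP/and3P => [[q + /and3P[/eqP <- /eqP <- g]]|[lti ltj g]].
  rewrite mem_iota LE /= add0n => qL.
  rewrite -divn_eq; split=> //; last exact: ltn_pmod.
  by rewrite ltn_divLR.
exists (i * n + j).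
  by rewrite mem_iota LE /=; nia.
by rewrite divnMDl // modnMDl divn_small // modn_small // addn0 !eqxx.
Qed.

Lemma evalP phi D d s rho : scoped D phi -> assigns s D rho ->
  s t_last =1 pred1 n.-1 ->
  forall p, den L (eval d phi) s (flag d) p = holds s rho phi.
Proof.
have L_gt0 : 0 < L by rewrite LE muln_gt0 n_gt0.
elim: phi D d s rho => [t x|x y|x y|phi IH|phi IHp psi IHq|x phi IH] D d s rho.
- case/andP=> _ xD as_ _ p; have [sx lt] := as_ x xD.
  by rewrite eval_testP (some_marked _ sx lt).
- case/andP=> xD yD as_ _ p; have [sx lt] := as_ x xD; have [sy _] := as_ y yD.
  by rewrite eval_testP (some_marked _ sx lt) sy.
- case/andP=> xD yD as_ la p.
  have [sx ltx] := as_ x xD; have [sy lty] := as_ y yD.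
  exact: (eval_adjP _ sx sy).
- by move=> c as_ la p; rewrite /= updE /= (IH D d s rho).
- move=> /= /andP[cp cq] as_ la p; rewrite /= updE /=.
  set s1 := den L (eval d phi) s.
  have s1E t : keeps D d t -> s1 t = s t by apply: eval_frame.
  rewrite (@eval_frame L psi D d.+1 s1 (flag d) cq) ?keeps_flag //
    {1}/s1 (IHp D d s rho) // -/s1.
  rewrite (IHq D d.+1 s1 rho) //.
  + rewrite (@eq_holds s1 s rho psi D cq) // => t tp.
    by rewrite s1E // /keeps tp.
  + move=> x xD; have [sx lt] := as_ x xD; split=> // q.
    by rewrite s1E ?keeps_var.
  + by move=> q; rewrite s1E.
- case/andP=> nx c as_ la p; rewrite [eval _ _]/=.
  set body := Seq (eval _ _) _; set s0 := den L (Assign (flag d) (BNot BTrue)) s.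
  pose I m (s' : store) := (forall t, keeps D d t -> s' t = s t) /\
    forall q, s' (flag d) q = has (fun i => holds s (bind rho x i) phi) (iota 0 m).
  have fv : flag d != var x by rewrite /flag /var; lia.
  have [||s' [_ Hs'] E] := @den_for I L (var x) body s0.
  + split=> [t k|q]; last by rewrite /s0 /= updE.
    by rewrite /s0 /= updN //; apply: contraTneq k => ->; rewrite keeps_flag ltnn.
  + move=> m s1 mL [ks1 fs1]; set s2 := upd s1 _ _.
    rewrite /body den_seq; set s3 := den L (eval _ _) s2.
    have s2E t : keeps D d t -> s2 t = s t.
      move=> k; rewrite /s2 updN ?ks1 //; apply: contraTneq k => ->.
      by rewrite keeps_var.
    have s3E t : keeps (x :: D) d.+1 t -> s3 t = s2 t by apply: eval_frame.
    have s3f q : s3 (flag d.+1) q = holds s (bind rho x m) phi.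
      rewrite /s3 (IH (x :: D) d.+1 s2 (bind rho x m)) //.
      * apply: (eq_holds _ c) => t tp; apply: s2E; by rewrite /keeps tp.
      * move=> z; rewrite inE /bind; case: eqVneq => [-> _|nz /= zD].
          by split=> // q'; rewrite /s2 updE.
        have [sz lt] := as_ z zD; split=> // q'.
        by rewrite s2E ?keeps_var.
      * by move=> q'; rewrite s2E.
    split=> [t k|q].
      rewrite /= updN; last by apply: contraTneq k => ->; rewrite keeps_flag ltnn.
      by rewrite s3E ?s2E //; apply: keeps_S; apply: keeps_cons.
    rewrite -[m.+1]addn1 iotaD has_cat /= updE /= s3f
      s3E ?keeps_flag // /s2 updN // fs1.
    by rewrite orbF add0n -negb_or negbK.
  by rewrite den_seq -/s0 E updN // Hs'.
Qed.

End Semantics.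

(** * Reduction rules for the covering problem *)

Section Reduction.
Variables (V : finType) (e : rel V).
Hypotheses (esym : symmetric e) (eirr : irreflexive e).
Implicit Types (S T N : {set V}) (x y z a b v w : V) (p : V * V) (P : seq (V * V)).

(* Pairs (u, u) are allowed: they touch u without spanning a block. *)
Definition touches p v := (p.1 == v) || (p.2 == v).
Definition touched P v := has (touches^~ v) P.
Definition pair_in S p := [&& p.1 \in S, p.2 \in S & (p.1 == p.2) || e p.1 p.2].
(** For an edge ab of a block graph this says that [p] is an edge of the same block disjoint from
    ab; stated by adjacency, it can be handled without mentioning blocks. *)
Definition spans a b p := [&& e p.1 p.2, e a p.1, e a p.2, e b p.1 & e b p.2].
Definition covered T P a b :=
  [|| a \in T, b \in T, touched P a, touched P b | has (spans a b) P].

Definition solves S T N P : Prop :=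
  [/\ all (pair_in S) P,
      {in S, forall v, v \in N -> (v \in T) || touched P v} &
      {in S &, forall a b, e a b -> covered T P a b}].

Definition simplicial S x :=
  ~~ [exists a in S, exists b in S, [&& e x a, e x b, a != b & ~~ e a b]].

(** A first-order substitute for a simplicial vertex of a leaf block: such a block has at most one
    cut vertex, hence [x] has at most one neighbour that is not simplicial. *)
Definition leafy S x := simplicial S x &&
  ~~ [exists a in S, exists b in S,
       [&& e x a, e x b, a != b, ~~ simplicial S a & ~~ simplicial S b]].

Lemma simplicialP S x : reflect
  {in S &, forall a b, e x a -> e x b -> a != b -> e a b} (simplicial S x).
Proof.
apply: (iffP negP) => [H a b aS bS xa xb ab|H].
  apply: contraT => nab; case: H; apply/exists_inP; exists a => //.
  by apply/exists_inP; exists b => //; rewrite xa xb ab nab.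
case/exists_inP=> a aS /exists_inP[b bS /and4P[xa xb ab]].
by rewrite H.
Qed.

Lemma leafyP S x : reflect (simplicial S x /\ {in S &, forall a b,
   e x a -> e x b -> a != b -> simplicial S a || simplicial S b}) (leafy S x).
Proof.
apply: (iffP andP) => -[sx H]; split=> //.
  move=> a b aS bS xa xb ab; apply: contraT; rewrite negb_or => /andP[na nb].
  case/negP: H; apply/exists_inP; exists a => //; apply/exists_inP.
  by exists b => //; rewrite xa xb ab na.
apply/negP => /exists_inP[a aS /exists_inP[b bS]].
case/and5P=> xa xb ab /negPf na /negPf nb.
by have := H a b aS bS xa xb ab; rewrite na nb.
Qed.

Lemma neq_adj x y : e x y -> x != y.
Proof. by move=> exy; apply/eqP => E; rewrite E eirr in exy. Qed.

Lemma coveredC T P a b : covered T P a b = covered T P b a.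
Proof.
rewrite /covered !orbA [(a \in T) || _]orbC -!orbA; congr [|| _, _ | _].
rewrite !orbA [touched P a || _]orbC -!orbA; congr [|| _, _ | _].
apply: eq_has => p; rewrite /spans.
by do 5!case: (e _ _).
Qed.

(* Before a simplicial vertex [y] is removed, a pair {y, w} is moved to {w, u}
   for another neighbour [u] of [y], so that it still spans the same block. *)
Definition push S x y p : V * V :=
  if touches p y then
    let w := if p.1 == y then p.2 else p.1 in
    if w == y then (x, x)
    else (w, if w == x then odflt x [pick z in S | e y z && (z != x)] else x)
  else p.

Lemma pushP S x y P : y \in S -> x \in S -> e y x -> simplicial S y ->
  all (pair_in S) P -> let P' := map (push S x y) P in
  [/\ all (pair_in (S :\ y)) P',
      forall v, v != y -> touched P v -> touched P' v,
      touched P y -> touched P' x &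
      forall T, {in S :\ y &, forall a b, covered T P a b -> covered T P' a b}].
Proof.
move=> yS xS yx sy okP P'.
have nxy : x != y by rewrite eq_sym neq_adj.
have tv v : v != y -> touched P v -> touched P' v.
  move=> nvy /hasP[p pP pv]; apply/hasP; exists (push S x y p).
    by apply: map_f.
  rewrite /push; case: ifP => // py.
  case/orP: pv => /eqP pv.
    have np1 : p.1 != y by rewrite pv.
    by rewrite (negPf np1) (negPf np1) /touches /= pv eqxx.
  case: (eqVneq p.1 y) => [p1y|np1]; first by rewrite pv (negPf nvy) /touches eqxx.
  by move: py; rewrite /touches (negPf np1) pv (negPf nvy).
split=> //.
- apply/allP => _ /mapP[p pP ->].
  have /and3P[p1 p2 p12] := allP okP p pP.
  rewrite /push; case: ifPn => [py|]; last first.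
    rewrite /touches negb_or => /andP[n1 n2].
    by rewrite /pair_in !inE n1 n2 p1 p2.
  set w := (if p.1 == y then p.2 else p.1).
  have wS : w \in S by rewrite /w; case: ifP.
  have yw : w != y -> e y w.
    rewrite /w; case: ifPn => [/eqP E|nE _].
      by rewrite eq_sym => ne; move: p12; rewrite E (negPf ne).
    move: py; rewrite /touches (negPf nE) => /= /eqP p2y.
    by move: p12; rewrite p2y (negPf nE) /= esym.
  case: ifPn => nwy; first by rewrite /pair_in /= !inE nxy xS eqxx.
  rewrite /pair_in /= !inE nwy wS /=.
  case: ifPn => [/eqP wx|nwx]; last first.
    by rewrite nxy xS /= (simplicialP _ _ sy) ?orbT // yw.
  case: pickP => [z /and3P[zS yz zx]|_] /=; last by rewrite nxy xS wx eqxx.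
  rewrite zS eq_sym (neq_adj yz) /= wx (simplicialP _ _ sy) ?orbT //.
  by rewrite eq_sym.
- case/hasP=> p pP py; apply/hasP; exists (push S x y p); first exact: map_f.
  rewrite /push py; set w := (if p.1 == y then p.2 else p.1).
  case: (eqVneq w y) => _; first by rewrite /touches eqxx.
  by case: (eqVneq w x) => [->|_]; rewrite /touches /= eqxx ?orbT.
- move=> T a b; rewrite !inE => /andP[ay aS] /andP[by' bS].
  case/or4P => [aT|bT|ta|/orP[tb|/hasP[p pP sp]]].
  + by rewrite /covered aT.
  + by rewrite /covered bT orbT.
  + by rewrite /covered (tv a) ?orbT.
  + by rewrite /covered (tv b) ?orbT.
  case py : (touches p y); last first.
    rewrite /covered; suff -> : has (spans a b) P' by rewrite !orbT.
    by apply/hasP; exists p => //; apply/mapP; exists p => //; rewrite /push py.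
  have pP' : push S x y p \in P' by apply: map_f.
  move: pP'; rewrite /push py.
  set w := (if p.1 == y then p.2 else p.1).
  have [yw ay' aw by2 bw] : [/\ e y w, e y a, e w a, e y b & e w b].
    case/and5P: sp => p12 a1 a2 b1 b2; rewrite /w.
    case: ifPn => [/eqP E|nE].
      by rewrite E in p12 a1 b1; split=> //; rewrite esym.
    move: py; rewrite /touches (negPf nE) /= => /eqP E; rewrite E in p12 a2 b2.
    by split=> //; rewrite esym.
  have nwy : w != y by rewrite eq_sym neq_adj.
  rewrite (negPf nwy); set u := if _ then _ else _ => pP'.
  have [uS yu wu] : [/\ u \in S, e y u & w != u].
    rewrite /u; case: ifPn => // /eqP wx.
    (* The default of [odflt] does not occur here: [a] is a neighbour of [y] other than [w], which
       is [x]. *)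
    case: pickP => [z /and3P[zS yz zx]|/(_ a)] /=.
      by rewrite wx eq_sym.
    by rewrite aS ay' -wx eq_sym (neq_adj aw).
  have [wS] : w \in S.
    by have /and3P[? ? _] := allP okP p pP; rewrite /w; case: ifP.
  rewrite /covered.
  case: (eqVneq a u) => [au|nau].
    suff -> : touched P' a by rewrite !orbT.
    by apply/hasP; exists (w, u) => //; rewrite /touches au eqxx orbT.
  case: (eqVneq b u) => [bu|nbu].
    suff -> : touched P' b by rewrite !orbT.
    by apply/hasP; exists (w, u) => //; rewrite /touches bu eqxx orbT.
  suff -> : has (spans a b) P' by rewrite !orbT.
  apply/hasP; exists (w, u) => //; have H := simplicialP _ _ sy.
  rewrite /spans /= [e a w]esym [e b w]esym aw bw.
  by rewrite (H w u) // (H a u) // (H b u).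
Qed.

(** The forward half of most rules: a simplicial vertex with a neighbour can be deleted at no extra
    cost, and its being touched is handed on to [x]. *)
Lemma push_solves S T N P x y : y \in S -> x \in S -> e y x -> simplicial S y ->
  solves S T N P -> exists P', [/\ solves (S :\ y) T N P', size P' = size P,
    forall v, v != y -> touched P v -> touched P' v &
    touched P y -> touched P' x].
Proof.
move=> yS xS yx sy [okP nP cP].
have [ok tv ty cov] := pushP yS xS yx sy okP.
exists (map (push S x y) P); rewrite size_map; split=> //; split=> //.
  move=> v; rewrite inE => /andP[/[!inE] ny vS] vN.
  by case/orP: (nP v vS vN) => [->//|/tv -> //]; rewrite orbT.
move=> a b aS bS eab; apply: cov => //.
by case/setD1P: aS => _ aS; case/setD1P: bS => _ bS; apply: cP.
Qed.

Lemma touches_adj S p y v :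
  pair_in S p -> touches p y -> touches p v -> v != y -> e y v.
Proof.
case: p => p1 p2 /and3P[_ _ /= p12].
case/orP=> /= /eqP <- /orP[] /= /eqP <-; rewrite ?eqxx // => ne.
  by move: p12; rewrite eq_sym (negPf ne).
by move: p12; rewrite (negPf ne) /= esym.
Qed.

Definition untouching y P := [seq p <- P | ~~ touches p y].

Lemma size_untouching y P : touched P y -> size (untouching y P) < size P.
Proof.
move=> tp; rewrite size_filter -(count_predC (touches^~ y) P).
by rewrite -[X in X < _]add0n ltn_add2r -has_count.
Qed.

Lemma pair_in_untouching S y P :
  all (pair_in S) P -> all (pair_in (S :\ y)) (untouching y P).
Proof.
move=> /allP ok; apply/allP => p; rewrite mem_filter /touches negb_or.
case/andP=> /andP[n1 n2] /ok /and3P[p1 p2 p12].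
by rewrite /pair_in !inE n1 n2 p1 p2 p12.
Qed.

(* The neighbours of [y] are all that the dropped pairs can have touched. *)
Lemma untouching_solves S T N P y (U : {set V}) : y \in S ->
  {in S, forall z, e y z -> z \in U} -> {in U &, forall a b, a = b} ->
  solves S T N P -> solves (S :\ y) (T :|: U) N (untouching y P).
Proof.
move=> yS yU U1 [okP nP cP].
have tv v : v \in S -> v != y -> touched P v ->
    (v \in U) || touched (untouching y P) v.
  move=> vS vy /hasP[p pP pv]; case py : (touches p y); last first.
    rewrite orbC (_ : touched _ _) //; apply/hasP; exists p => //.
    by rewrite mem_filter py.
  by rewrite yU // (touches_adj (allP okP p pP)).
split; first exact: pair_in_untouching.
  move=> v /setD1P[vy vS] vN; rewrite inE.
  by case/orP: (nP v vS vN) => [->//|/(tv v vS vy)]; rewrite -orbA => ->;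
    rewrite orbT.
move=> a b /setD1P[ay aS] /setD1P[by' bS] eab.
rewrite /covered !inE.
case/or4P: (cP a b aS bS eab) => [->|->|/(tv a aS ay)|].
- by [].
- by rewrite !orbT.
- by case/orP => ->; rewrite !orbT.
case/orP => [/(tv b bS by')|/hasP[p pP sp]].
  by case/orP => ->; rewrite !orbT.
case py : (touches p y); last first.
  suff -> : has (spans a b) (untouching y P) by rewrite !orbT.
  by apply/hasP; exists p => //; rewrite mem_filter py.
have [ya yb] : e y a /\ e y b.
  case/and5P: sp => _ a1 a2 b1 b2.
  by case/orP: py => /eqP <-; rewrite ![e _ a]esym ![e _ b]esym.
by rewrite (U1 a b) ?eirr // in eab; apply: yU.
Qed.

(* Passing from (S, T, N) to (S', T', N') lowers the optimum by exactly [c]. *)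
Definition sound S T N S' T' N' c :=
  (forall P, solves S T N P ->
     exists2 P', solves S' T' N' P' & size P' + c <= size P) /\
  (forall P', solves S' T' N' P' ->
     exists2 P, solves S T N P & size P <= size P' + c).

Lemma pair_in_sub (S S' : {set V}) P :
  S \subset S' -> all (pair_in S) P -> all (pair_in S') P.
Proof.
move=> /subsetP sS /allP ok; apply/allP => p /ok /and3P[p1 p2 p12].
by rewrite /pair_in !sS.
Qed.

Lemma covered_cons T P p a b : covered T P a b -> covered T (p :: P) a b.
Proof.
rewrite /covered /=.
by case/or4P => [->|->|->|/orP[->|->]]; rewrite ?orbT.
Qed.

(** All edges at a sated vertex are covered, so [x] can be put back for free; conversely its pairs
    are pushed to a neighbour, or dropped if there is none. *)
Lemma sound_touched_simplicial S T N x : x \in S -> x \in T ->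
  simplicial S x -> sound S T N (S :\ x) T N 0.
Proof.
move=> xS xT sx; split=> [P sol|P [ok n c]].
  case: (pickP [pred z in S | e x z]) => [z /andP[zS xz]|no].
    have [P' [sol' sz _ _]] := push_solves xS zS xz sx sol.
    by exists P' => //; rewrite sz addn0.
  exists (untouching x P); last by rewrite addn0 size_filter count_size.
  rewrite -[T]setU0; apply: untouching_solves => //.
    by move=> z zS xz; have := no z; rewrite /= zS xz.
  by move=> a b; rewrite inE.
exists P; last by rewrite addn0.
split; first by apply: pair_in_sub ok; rewrite subD1set.
  move=> v vS vN; case: (eqVneq v x) => [->|nv]; first by rewrite xT.
  by apply: n; rewrite // !inE nv.
move=> a b aS bS eab.
case: (eqVneq a x) => [->|na]; first by rewrite /covered xT.
case: (eqVneq b x) => [->|nb]; first by rewrite /covered xT orbT.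
by apply: c; rewrite // !inE ?na ?nb.
Qed.

(** Only loops can touch [x], and one of them is required exactly if [x] is needy. *)
Lemma sound_isolated S T N x : x \in S -> x \notin T ->
  {in S, forall z, ~~ e x z} -> sound S T N (S :\ x) T N (x \in N).
Proof.
move=> xS nxT iso; split=> [P sol|P [ok n c]].
  exists (untouching x P).
    rewrite -[T]setU0; apply: untouching_solves => //.
      by move=> z /iso /negPf ->.
    by move=> a b; rewrite inE.
  case xN : (x \in N); last by rewrite addn0 size_filter count_size.
  rewrite addn1 size_untouching //; case: sol => _ n _.
  by have := n x xS xN; rewrite (negPf nxT).
exists (if x \in N then (x, x) :: P else P); last by case: ifP; rewrite /=; lia.
have cov a b : a \in S -> b \in S -> e a b -> covered T P a b.
  move=> aS bS eab; apply: c; rewrite // !inE ?aS ?bS andbT.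
    by apply: contraTneq eab => ->; apply: iso.
  by apply: contraTneq eab => ->; rewrite esym; apply: iso.
have ok' : all (pair_in S) P by apply: pair_in_sub ok; rewrite subD1set.
case: ifP => xN; split=> //=.
- by rewrite ok' /pair_in /= xS eqxx.
- move=> v vS vN; case: (eqVneq v x) => [->|nv].
    by rewrite /touched /= /touches eqxx /= orbT.
  by have := n v; rewrite !inE nv vS => /(_ isT vN) /orP[->|->]; rewrite ?orbT.
- by move=> a b aS bS eab; apply: covered_cons; apply: cov.
- move=> v vS vN; apply: n => //; rewrite !inE vS andbT.
  by apply: contraTneq vN => ->; rewrite xN.
Qed.

Lemma touched_unloop P x y v : touched P v ->
  touched [seq if p == (x, x) then (x, y) else p | p <- P] v.
Proof.
case/hasP=> p pP pv; apply/hasP.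
exists (if p == (x, x) then (x, y) else p); first exact: (map_f (fun p => _)).
case: eqP => // E; move: pv; rewrite E /touches /= => /orP[] ->.
all: by rewrite ?orbT.
Qed.

(* Loops at [x] are replaced by the pair {x, y}; then some pair at [x] spans
   every edge of the block of [x] and [y]. *)
Lemma twin_solves S T N P x y : x \in S -> y \in S -> e x y ->
  simplicial S x -> simplicial S y -> y \notin N -> touched P x ->
  solves (S :\ y) T N P -> exists2 P', solves S T N P' & size P' = size P.
Proof.
move=> xS yS xy sx sy yN tx [ok n c].
pose f p := if p == (x, x) then (x, y) else p.
exists (map f P); last by rewrite size_map.
have tf v : touched P v -> touched (map f P) v by apply: touched_unloop.
have cov_y b : b \in S -> e y b -> covered T (map f P) y b.
  move=> bS yb; have := tf _ tx; case/hasP=> q /mapP[p pP ->] px.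
  case: (eqVneq b x) => [->|nbx].
    by rewrite /covered (tf x tx) !orbT.
  rewrite /covered; suff : [|| touched (map f P) y, touched (map f P) b |
    has (spans y b) (map f P)] by case/or3P => ->; rewrite ?orbT.
  have fpP : f p \in map f P by apply: map_f.
  move: px fpP; rewrite /f; case: (eqVneq p (x, x)) => [_ _|npx px] fpP.
    apply/orP; left; apply/hasP; exists (x, y) => //.
    by rewrite /touches /= eqxx orbT.
  have [w [wp xw wS wy]] : exists w, [/\ touches p w, e x w, w \in S & w != y].
    have := allP ok p pP; case: (p) npx px => p1 p2 npx px.
    case/and3P => /=; rewrite !inE => /andP[n1 p1S] /andP[n2 p2S] p12.
    case/orP: px p12 => /= /eqP E; rewrite E in npx *.
      case/orP => [/eqP F|F]; first by rewrite F eqxx in npx.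
      by exists p2; rewrite /touches /= eqxx orbT.
    case/orP => [/eqP F|F]; first by rewrite F eqxx in npx.
    by exists p1; rewrite /touches /= eqxx esym.
  case: (eqVneq w b) => [wb|nwb].
    apply/orP; right; apply/orP; left; apply/hasP; exists p => //.
    by rewrite -wb.
  apply/orP; right; apply/orP; right; apply/hasP; exists p => //.
  have yx : e y x by rewrite esym.
  have xb : e x b by apply: (simplicialP _ _ sy); rewrite // eq_sym.
  have yw : e y w by apply: (simplicialP _ _ sx); rewrite // eq_sym.
  have bw : e b w by apply: (simplicialP _ _ sx); rewrite // eq_sym.
  have bx : e b x by rewrite esym.
  have wx : e w x by rewrite esym.
  have nwx : w != x by apply: neq_adj.
  have -> : p = (x, w) \/ p = (w, x) -> spans y b p.
    by case=> ->; rewrite /spans /= ?xw ?wx yx yw bx bw.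
  by [].
  case: (p) px wp => p1 p2; rewrite /touches /=.
  case/orP => /eqP ->.
    by rewrite [x == w]eq_sym (negPf nwx) /= => /eqP ->; left.
  by rewrite [x == w]eq_sym (negPf nwx) orbF => /eqP ->; right.
split.
- apply/allP => _ /mapP[p pP ->]; rewrite /f; case: eqP => _.
    by rewrite /pair_in /= xS yS xy orbT.
  by apply: (allP (pair_in_sub (subD1set S y) ok)).
- move=> v vS vN; have nvy : v != y by apply: contraNneq yN => <-.
  have := n v; rewrite !inE nvy vS => /(_ isT vN).
  by case/orP => [->//|/tf ->]; rewrite orbT.
- move=> a b aS bS eab.
  case: (eqVneq a y) => [E|na]; first by rewrite E in eab *; apply: cov_y.
  case: (eqVneq b y) => [E|nb].
    by rewrite E coveredC in eab *; apply: cov_y; rewrite // esym.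
  have := c a b; rewrite !inE na nb aS bS => /(_ isT isT eab).
  rewrite /covered; case/or4P => [->|->|/tf ->|]; rewrite ?orbT //.
  case/orP => [/tf ->|/hasP[p pP sp]]; rewrite ?orbT //.
  suff -> : has (spans a b) (map f P) by rewrite !orbT.
  apply/hasP; exists p => //; apply/mapP; exists p => //.
  by rewrite /f; case: eqP => // E; move: sp; rewrite E /spans /= eirr.
Qed.

(** Some pair has to touch [x] anyway, and it can be arranged to take care of all edges of [y] as
    well. *)
Lemma sound_twin S T N x y : x \in S -> y \in S -> e x y ->
  simplicial S x -> simplicial S y -> x \notin T -> x \in N -> y \notin N ->
  sound S T N (S :\ y) T N 0.
Proof.
move=> xS yS xy sx sy nxT xN nyN; have yx : e y x by rewrite esym.
split=> P sol.
  have [P' [sol' sz _ _]] := push_solves yS xS yx sy sol.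
  by exists P' => //; rewrite sz addn0.
have tx : touched P x.
  case: sol => _ n _; have := n x; rewrite !inE neq_adj // xS (negPf nxT).
  exact.
have [P' sol' sz] := twin_solves xS yS xy sx sy nyN tx sol.
by exists P' => //; rewrite sz addn0.
Qed.

(** As [u] is simplicial, all its edges lie in one block with [x] and [w]. Replacing {u, w} by {x,
    w} keeps them covered and gains a touch of [x]; the touch of [u] that is lost was not
    demanded. *)
Lemma swap_solves S T N P p x u w : p \in P -> p = (u, w) \/ p = (w, u) ->
  x \in S -> u \in S -> w \in S -> e x u -> e x w -> e u w ->
  simplicial S u -> u \notin N -> solves S T N P ->
  exists P', [/\ solves S T N P', size P' = size P & touched P' x].
Proof.
move=> pP pE xS uS wS xu xw uw su nuN [ok n c].
pose f q := if q == p then (x, w) else q.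
have xwP : (x, w) \in map f P.
  by apply/mapP; exists p; rewrite // /f eqxx.
have tx : touched (map f P) x.
  by apply/hasP; exists (x, w); rewrite // /touches eqxx.
have tw : touched (map f P) w.
  by apply/hasP; exists (x, w); rewrite // /touches eqxx orbT.
have tf v : v != u -> touched P v -> touched (map f P) v.
  move=> vu /hasP[q qP qv]; case: (eqVneq q p) => [E|nE].
    suff -> : v = w by [].
    move: qv; rewrite E; case: pE => ->; rewrite /touches /= ![_ == v]eq_sym
      (negPf vu) ?orbF; by move/eqP.
  by apply/hasP; exists q => //; apply/mapP; exists q; rewrite // /f (negPf nE).
have span a b : a \in S -> b \in S -> e u a || (u == a) -> e w a || (w == a) ->
    e u b -> e w b || (w == b) -> covered T (map f P) a b.
  move=> aS bS ua wa ub wb; rewrite /covered.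
  case: (eqVneq a x) => [->|nax]; first by rewrite tx !orbT.
  case: (eqVneq b x) => [->|nbx]; first by rewrite tx !orbT.
  case: (eqVneq a w) => [->|naw]; first by rewrite tw !orbT.
  case: (eqVneq b w) => [->|nbw]; first by rewrite tw !orbT.
  suff -> : has (spans a b) (map f P) by rewrite !orbT.
  apply/hasP; exists (x, w) => //.
  rewrite [w == a]eq_sym (negPf naw) orbF in wa.
  rewrite [w == b]eq_sym (negPf nbw) orbF in wb.
  rewrite /spans /= xw [e a w]esym [e b w]esym wa wb.
  have bx : e b x by apply: (simplicialP _ _ su); rewrite // esym.
  rewrite bx !andbT; case: (eqVneq u a) ua => [<-|_]; first by rewrite esym.
  by rewrite orbF => ua; apply: (simplicialP _ _ su); rewrite // esym.
have cov_u b : b \in S -> e u b -> covered T (map f P) u b.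
  move=> bS ub; apply: span; rewrite ?eqxx ?orbT //; first by rewrite esym uw.
  case: (eqVneq w b) => [//|nwb]; first by rewrite orbT.
  by rewrite orbF; apply: (simplicialP _ _ su).
exists (map f P); rewrite size_map; split=> //; split.
- apply/allP => _ /mapP[q qP ->]; rewrite /f; case: eqP => _.
    by rewrite /pair_in /= xS wS xw orbT.
  exact: (allP ok).
- move=> v vS vN; have nvu : v != u by apply: contraNneq nuN => <-.
  by case/orP: (n v vS vN) => [->//|/(tf v nvu) ->]; rewrite orbT.
- move=> a b aS bS eab.
  case: (eqVneq a u) => [E|na]; first by rewrite E in eab *; apply: cov_u.
  case: (eqVneq b u) => [E|nb].
    by rewrite E coveredC in eab *; apply: cov_u; rewrite // esym.
  case/or4P: (c a b aS bS eab) => [aT|bT|ta|/orP[tb|/hasP[q qP sp]]].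
  + by rewrite /covered aT.
  + by rewrite /covered bT orbT.
  + by rewrite /covered (tf a na ta) !orbT.
  + by rewrite /covered (tf b nb tb) !orbT.
  case: (eqVneq q p) => [E|nE].
    move: sp; rewrite E; case: pE => ->; case/and5P => /= _ a1 a2 b1 b2;
      by apply: span => //; rewrite esym ?a1 ?a2 ?b1 ?b2.
  suff sp' : has (spans a b) (map f P) by rewrite /covered sp' !orbT.
  by apply/hasP; exists q => //; apply/mapP; exists q; rewrite // /f (negPf nE).
Qed.

(** The edge xy has to be covered, by a touch of [x] or [y] or by a spanning pair. A spanning pair
    has a simplicial end by leafiness and can be swapped to touch [x]; a touch of [y] is pushed to
    [x]. So [x] may be declared needy, and then [y] is a twin. *)
Lemma sound_leafy_free S T N x y : x \in S -> y \in S -> e x y ->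
  leafy S x -> simplicial S y -> x \notin T -> x \notin N ->
  {in S, forall z, e x z -> simplicial S z -> (z \notin T) && (z \notin N)} ->
  sound S T N (S :\ y) T (x |: N) 0.
Proof.
move=> xS yS xy /leafyP[sx lx] sy nxT nxN unif; have yx : e y x by rewrite esym.
have /andP[nyT nyN] := unif y yS xy sy.
split=> P sol.
  have [P1 [sol1 sz1 t1]] : exists P1, [/\ solves S T N P1, size P1 = size P &
      touched P1 x || touched P1 y].
    case: (sol) => ok n c; have := c x y xS yS xy; rewrite /covered.
    rewrite (negPf nxT) (negPf nyT) /= orbA.
    case/orP => [txy|/hasP[p pP sp]]; first by exists P.
    have /and3P[p1S p2S _] := allP ok p pP.
    case/and5P: sp => p12 x1 x2 _ _.
    case/orP: (lx _ _ p1S p2S x1 x2 (neq_adj p12)) => sp.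
      have /andP[_ nN] := unif _ p1S x1 sp.
      have [|P1 [s1 z1 t1]] := swap_solves pP _ xS p1S p2S x1 x2 p12 sp nN sol.
      - by left; case: (p).
      - by exists P1; rewrite t1.
    have /andP[_ nN] := unif _ p2S x2 sp.
    rewrite esym in p12.
    have [|P1 [s1 z1 t1]] := swap_solves pP _ xS p2S p1S x2 x1 p12 sp nN sol.
    - by right; case: (p).
    - by exists P1; rewrite t1.
  have [P' [sol' sz tv ty]] := push_solves yS xS yx sy sol1.
  exists P'; last by rewrite addn0 sz sz1.
  case: sol' => ok n c; split=> // v vS; rewrite inE => /orP[/set1P->|vN].
    by case/orP: t1 => [/(tv x (neq_adj xy))->|/ty->]; rewrite orbT.
  exact: n.
have tx : touched P x.
  case: sol => _ n _; have := n x; rewrite !inE neq_adj // xS (negPf nxT) eqxx.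
  exact.
have [|P' sol' sz] := @twin_solves S T N P x y xS yS xy sx sy nyN tx.
  case: sol => ok n c; split=> // v vS vN; apply: n => //.
  by rewrite inE vN orbT.
by exists P' => //; rewrite sz addn0.
Qed.

Definition partner x y p :=
  if p.1 \notin [:: x; y] then Some p.1
  else if p.2 \notin [:: x; y] then Some p.2 else None.

(* The partners of [x] and [y] are joined by one pair, which saves a pair; the
   other vertices of the block but at most one are needy, so the edges of the block
   are touched anyway. *)
Lemma sound_leafy_demand S T N x y : x \in S -> y \in S -> e x y ->
  leafy S x -> simplicial S y -> x \notin T -> x \in N ->
  {in S, forall z, e x z -> simplicial S z -> (z \notin T) && (z \in N)} ->
  sound S T N (S :\ x :\ y) T N 1.
Proof.
move=> xS yS xy /leafyP[sx lx] sy nxT xN unif.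
have /andP[nyT yN] := unif y yS xy sy.
have nxy := neq_adj xy.
split=> P.
  move=> [ok n c].
  pose at_xy p := touches p x || touches p y.
  pose A := [seq p <- P | ~~ at_xy p]; pose B := [seq p <- P | at_xy p].
  pose ws := pmap (partner x y) B.
  have wsP w : w \in ws -> [/\ w \in S, w != x, w != y & e x w].
    rewrite mem_pmap => /mapP[p]; rewrite mem_filter => /andP[pxy pP].
    have okp := allP ok p pP; have /and3P[p1S p2S _] := okp.
    have adj v : v \in S -> touches p v -> v != x -> v != y -> e x v.
      move=> vS pv vx vy; case/orP: pxy => pxy.
        exact: touches_adj okp _ _ _.
      have yv : e y v by apply: touches_adj okp _ _ _.
      by apply: (simplicialP _ _ sy); rewrite // 1?esym // eq_sym.
    rewrite /partner; case: ifP => [+ [->]|_].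
      rewrite !inE negb_or => /andP[wx wy]; split=> //.
      by apply: adj; rewrite // /touches eqxx.
    case: ifP => // + [->]; rewrite !inE negb_or => /andP[wx wy]; split=> //.
    by apply: adj; rewrite // /touches eqxx orbT.
  have le_ws : size ws <= size B by rewrite size_pmap count_size.
  have [R [okR szR tR]] : exists R, [/\ all (pair_in (S :\ x :\ y)) R,
      size R < size B & {in ws, forall w, touched R w}].
    have loops : forall s : seq V, {subset s <= ws} ->
        all (pair_in (S :\ x :\ y)) [seq (w, w) | w <- s] /\
        {in s, forall w, touched [seq (w, w) | w <- s] w}.
      move=> s sub; split.
        apply/allP => _ /mapP[w /sub/wsP[wS wx wy _] ->].
        by rewrite /pair_in /= !inE wx wy wS eqxx.
      move=> w ws'; apply/hasP; exists (w, w); last by rewrite /touches eqxx.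
      by apply/mapP; exists w.
    (* If some pair at [x] or [y] has no partner, loops at the partners of the others already save a
       pair. *)
    case: (ltnP (size ws) (size B)) => [lt|ge].
      have [ok' t'] := loops ws (fun _ h => h).
      by exists [seq (w, w) | w <- ws]; rewrite size_map.
    have szE : size ws = size B by apply/eqP; rewrite eqn_leq le_ws.
    have some p : p \in B -> isSome (partner x y p).
      move: szE; rewrite size_pmap => /eqP; rewrite -all_count => /allP H pB.
      exact: H.
    have tx : touched P x by have := n x xS xN; rewrite (negPf nxT).
    have ty : touched P y by have := n y yS yN; rewrite (negPf nyT).
    (* Every pair in [B] now has a partner, so none is {x, y}. Hence [x] and [y] are touched by
       different pairs, and there are two partners to be joined, possibly to a loop. *)
    have lt1 : 1 < size B.
      case/hasP: tx => p pP px; case/hasP: ty => q qP qy.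
      have pB : p \in B by rewrite mem_filter /at_xy px.
      have qB : q \in B by rewrite mem_filter /at_xy qy orbT.
      have npq : p != q.
        apply: contraTneq (some p pB) => E; rewrite -E in qy.
        rewrite /partner !inE.
        move: px qy nxy; rewrite /touches.
        case: (eqVneq p.1 x) => [->|_]; first by
          rewrite /= => _ /orP[/eqP->|/eqP->]; rewrite eqxx ?orbT.
        by rewrite /= => /eqP -> /orP[->|/eqP->]; rewrite ?orbT eqxx.
      case: (B) pB qB => [|b1 [|b2 l]] //.
      by rewrite !inE => /eqP E /eqP F; rewrite E F eqxx in npq.
    case E : ws szE wsP loops => [|w1 [|w2 l]] szE wsP loops;
      rewrite -szE ?ltnn // in lt1.
    have [|ok' t'] := loops l.
      by move=> w wl; rewrite !inE wl !orbT.
    exists ((w1, w2) :: [seq (w, w) | w <- l]); split.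
    - rewrite /= ok' andbT.
      have [|w1S w1x w1y xw1] := wsP w1; first by rewrite inE eqxx.
      have [|w2S w2x w2y xw2] := wsP w2; first by rewrite !inE eqxx orbT.
      rewrite /pair_in /= !inE w1S w1x w1y w2S w2x w2y /=.
      case: eqVneq => //= ne; exact: (simplicialP _ _ sx).
    - by rewrite /= size_map -szE.
    - move=> w; rewrite !inE orbA => /orP[ww|wl]; rewrite /touched /=.
        by rewrite /touches /= ![_ == w]eq_sym ww.
      by rewrite -/(touched _ w) t' ?orbT.
  exists (A ++ R); last first.
    rewrite size_cat -(count_predC at_xy P) -!size_filter -/B addn1 -addnS.
    by rewrite [X in _ <= X]addnC leq_add2l.
  have tA v : v != x -> v != y -> touched P v -> touched (A ++ R) v.
    move=> vx vy /hasP[p pP pv]; rewrite /touched has_cat.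
    case pxy : (at_xy p); last first.
      suff -> : has (touches^~ v) A by [].
      by apply/hasP; exists p; rewrite // mem_filter pxy.
    suff -> : has (touches^~ v) R by rewrite orbT.
    apply: tR; rewrite mem_pmap; apply/mapP; exists p.
      by rewrite mem_filter pxy.
    move: pxy pv; rewrite /at_xy /touches /partner !inE.
    case: (eqVneq p.1 v) => [->|n1] /=.
      by rewrite (negPf vx) (negPf vy).
    move=> pxy /eqP p2v; rewrite p2v (negPf vx) (negPf vy) /= !orbF in pxy *.
    by rewrite pxy.
  split.
  - rewrite all_cat okR andbT; apply/allP => p.
    rewrite mem_filter /at_xy /touches !negb_or => /andP[].
    case/andP=> /andP[n1 n2] /andP[n3 n4] pP.
    have /and3P[p1 p2 p12] := allP ok p pP.
    by rewrite /pair_in !inE n1 n2 n3 n4 p1 p2 p12.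
  - move=> v; rewrite !inE => /and3P[vy vx vS] vN.
    by case/orP: (n v vS vN) => [->//|/(tA v vx vy) ->]; rewrite orbT.
  - move=> a b; rewrite !inE => /and3P[ay ax aS] /and3P[by' bx bS] eab.
    case/or4P: (c a b aS bS eab) => [aT|bT|ta|/orP[tb|/hasP[q qP sp]]].
    + by rewrite /covered aT.
    + by rewrite /covered bT orbT.
    + by rewrite /covered (tA a ax ay ta) !orbT.
    + by rewrite /covered (tA b bx by' tb) !orbT.
    case qxy : (at_xy q); last first.
      suff sp' : has (spans a b) (A ++ R) by rewrite /covered sp' !orbT.
      by apply/hasP; exists q; rewrite // mem_cat mem_filter qxy qP.
    have xq v : v \in S -> v != x -> e v q.1 -> e v q.2 -> e x v.
      move=> vS vx v1 v2; case/orP: qxy => /orP[] /eqP E; rewrite E in v1 v2.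
      + by rewrite esym.
      + by rewrite esym.
      + by apply: (simplicialP _ _ sy); rewrite // 1?esym // eq_sym.
      + by apply: (simplicialP _ _ sy); rewrite // 1?esym // eq_sym.
    case/and5P: sp => _ a1 a2 b1 b2.
    have xa := xq a aS ax a1 a2; have xb := xq b bS bx b1 b2.
    case/orP: (lx a b aS bS xa xb (neq_adj eab)) => sab.
      have /andP[naT aN] := unif a aS xa sab.
      have := n a aS aN; rewrite (negPf naT) => /(tA a ax ay) ta.
      by rewrite /covered ta !orbT.
    have /andP[nbT bN] := unif b bS xb sab.
    have := n b bS bN; rewrite (negPf nbT) => /(tA b bx by') tb.
    by rewrite /covered tb !orbT.
move=> [ok n c]; exists ((x, y) :: P); last by rewrite /= addn1.
have tx : touched ((x, y) :: P) x by rewrite /touched /= /touches /= eqxx.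
have ty : touched ((x, y) :: P) y by rewrite /touched /= /touches /= eqxx orbT.
split.
- rewrite /= /pair_in /= xS yS xy orbT; apply: pair_in_sub ok.
  by apply: subset_trans (subD1set _ _) (subD1set _ _).
- move=> v vS vN; case: (eqVneq v x) => [->|vx]; first by rewrite tx orbT.
  case: (eqVneq v y) => [->|vy]; first by rewrite ty orbT.
  have := n v; rewrite !inE vx vy vS => /(_ isT vN).
  by case/orP => [->//|tv]; rewrite /touched /= -/(touched P v) tv !orbT.
- move=> a b aS bS eab; rewrite /covered.
  case: (eqVneq a x) => [->|ax]; first by rewrite tx !orbT.
  case: (eqVneq a y) => [->|ay]; first by rewrite ty !orbT.
  case: (eqVneq b x) => [->|bx]; first by rewrite tx !orbT.
  case: (eqVneq b y) => [->|by']; first by rewrite ty !orbT.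
  by apply: covered_cons; apply: c; rewrite // !inE ?ax ?ay ?bx ?by'.
Qed.

Lemma pendant_simplicial S x y :
  {in S, forall z, e x z -> z = y} -> simplicial S x.
Proof.
move=> x1; apply/simplicialP => a b aS bS xa xb.
by rewrite (x1 a) // (x1 b) // eqxx.
Qed.

(** A pair touching [x] touches at most [y] besides, so {x, y} is the best choice; it makes [y]
    sated for the rest. *)
Lemma sound_pendant_demand S T N x y : x \in S -> y \in S -> e x y ->
  {in S, forall z, e x z -> z = y} -> x \notin T -> x \in N ->
  sound S T N (S :\ x) (y |: T) N 1.
Proof.
move=> xS yS xy x1 nxT xN; split=> P sol.
  exists (untouching x P).
    rewrite setUC; apply: untouching_solves sol => //.
      by move=> z zS xz; rewrite inE (x1 z).
    by move=> a b /set1P -> /set1P ->.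
  rewrite addn1 size_untouching //; case: sol => _ n _.
  by have := n x xS xN; rewrite (negPf nxT).
case: sol => ok n c; exists ((x, y) :: P); last by rewrite /= addn1.
have tx : touched ((x, y) :: P) x by rewrite /touched /= /touches /= eqxx.
have ty : touched ((x, y) :: P) y by rewrite /touched /= /touches /= eqxx orbT.
split.
- rewrite /= /pair_in /= xS yS xy orbT; apply: pair_in_sub ok.
  exact: subD1set.
- move=> v vS vN; case: (eqVneq v x) => [->|vx]; first by rewrite tx orbT.
  case: (eqVneq v y) => [->|vy]; first by rewrite ty orbT.
  have := n v; rewrite !inE vx vS (negPf vy) => /(_ isT vN) /=.
  by case/orP => [->//|tv]; rewrite /touched /= -/(touched P v) tv !orbT.
- move=> a b aS bS eab.
  case: (eqVneq a x) => [->|ax]; first by rewrite /covered tx !orbT.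
  case: (eqVneq b x) => [->|bx]; first by rewrite /covered tx !orbT.
  case: (eqVneq a y) => [->|ay]; first by rewrite /covered ty !orbT.
  case: (eqVneq b y) => [->|by']; first by rewrite /covered ty !orbT.
  apply: covered_cons; have := c a b; rewrite !inE ax bx aS bS.
  by rewrite /covered !inE (negPf ay) (negPf by') => /(_ isT isT eab).
Qed.

(** The edge xy lies in no triangle, so no pair spans it. It is covered by a touch of [x] or of [y],
    and a touch of [y] is at least as good. *)
Lemma sound_pendant_free S T N x y : x \in S -> y \in S -> e x y ->
  {in S, forall z, e x z -> z = y} -> x \notin T -> x \notin N ->
  sound S T N (S :\ x) T (y |: N) 0.
Proof.
move=> xS yS xy x1 nxT nxN; split=> P sol.
  have [P' [sol' sz tv tx]] :=
    push_solves xS yS xy (pendant_simplicial x1) sol.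
  exists P'; last by rewrite addn0 sz.
  case: sol' => ok' n' c'; split=> // v vS; rewrite inE => /orP[/set1P->|vN];
    last exact: n'.
  case: sol => ok n c; have := c x y xS yS xy.
  case/or4P => [xT|->//|/tx->|/orP[ty|/hasP[p pP sp]]]; rewrite ?orbT //.
  - by rewrite xT in nxT.
  - by rewrite tv ?orbT // eq_sym neq_adj.
  have /and3P[p1S p2S _] := allP ok p pP.
  case/and5P: sp => p12 xp1 xp2 _ _.
  by rewrite (x1 _ p1S xp1) (x1 _ p2S xp2) eirr in p12.
exists P; last by rewrite addn0.
case: sol => ok n c.
have ty : (y \in T) || touched P y.
  by apply: n; rewrite !inE ?eqxx // yS eq_sym neq_adj.
split.
- by apply: pair_in_sub ok; apply: subD1set.
- move=> v vS vN; apply: n; rewrite !inE ?vN ?orbT // vS andbT.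
  by apply: contraNneq nxN => <-.
- move=> a b aS bS eab.
  case: (eqVneq a x) => [E|ax].
    have by' : b = y by apply: x1; rewrite // -E.
    by rewrite /covered by'; case/orP: ty => ->; rewrite ?orbT.
  case: (eqVneq b x) => [E|bx].
    have ay : a = y by apply: x1; rewrite // -E esym.
    by rewrite /covered ay; case/orP: ty => ->; rewrite ?orbT.
  by apply: c; rewrite // !inE ?ax ?bx.
Qed.

End Reduction.

(** * Leaf blocks *)

Section BlockGraph.
Variables (n : nat) (e : rel 'I_n).
Hypotheses (esym : symmetric e) (eirr : irreflexive e) (blk : block_graph e).
Implicit Types (S : {set 'I_n}) (x y z a b c d q : 'I_n).

Definition within S := [rel a b | [&& e a b, a \in S & b \in S]].

Lemma within_sym S : connect_sym (within S).
Proof.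
apply: sym_connect_sym => a b; rewrite /within /= esym.
by congr (_ && _); apply: andbC.
Qed.

Lemma path_within S x p : {subset x :: p <= S} -> path e x p ->
  path (within S) x p.
Proof.
elim: p x => //= y p IH x sub /andP[xy py]; rewrite xy !sub ?inE ?eqxx ?orbT //=.
by apply: IH => // z zp; apply: sub; rewrite inE zp orbT.
Qed.

Lemma path_induced_connected x p S : S =i x :: p -> path e x p ->
  induced_connected e S.
Proof.
move=> SE ep a b; rewrite !SE => ax bx.
have sub : {subset x :: p <= S} by move=> z; rewrite SE.
have C z : z \in x :: p -> connect (within S) x z.
  by apply: path_connect; apply: path_within.
by apply: connect_trans (C b bx); rewrite -/(within S) within_sym C.
Qed.

(** Deleting a vertex from a cycle leaves a path. *)
Lemma cycle_nonseparable (s : seq 'I_n) : s != [::] -> uniq s -> cycle e s ->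
  nonseparable e [set z in s].
Proof.
move=> s0 us cs; split.
  by case: s s0 {us cs} => // x s _; apply/set0Pn; exists x; rewrite !inE eqxx.
split.
  case: s s0 cs {us} => // x p _ /=; rewrite rcons_path => /andP[ep _].
  by apply: path_induced_connected ep => z; rewrite inE.
move=> v; rewrite inE => /rot_to[i p sE].
have up : uniq (v :: p) by rewrite -sE rot_uniq.
have : cycle e (v :: p) by rewrite -sE rot_cycle.
have memE z : (z \in [set z in s] :\ v) = (z \in p).
  rewrite !inE -(mem_rot i) sE inE.
  by case: eqP up => [->|] //=; case: (v \in p).
case: p {sE} up memE => [|y p] up memE /=; first by
  move=> _ a b; rewrite memE.
rewrite rcons_path => /and3P[_ ep _].
exact: path_induced_connected ep.
Qed.

(** [S] is enlarged until it is maximal, hence a block; the induction is on the room left above its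
    size. *)
Lemma nonseparable_clique S : nonseparable e S ->
  {in S &, forall x y, x != y -> e x y}.
Proof.
have cardT (T : {set 'I_n}) : #|T| <= n.
  by rewrite -[X in _ <= X]card_ord max_card.
move: {2}(n - #|S|) (leqnn (n - #|S|)) => k.
elim: k S => [|k IH] S le ns x y xS yS xy.
  apply: (blk (S := S)) => //; split=> // T sST nT.
  apply/eqP; rewrite eq_sym eqEcard sST /=.
  by apply: leq_trans (cardT T) _; rewrite -subn_eq0 -leqn0.
have [[T [sST nT neq]]|no] := classic (exists T : {set 'I_n},
    [/\ S \subset T, nonseparable e T & T != S]).
  apply: (IH T) => //; try exact: (subsetP sST).
  have : S \proper T by rewrite properEneq eq_sym neq.
  move/proper_card => lt; rewrite -ltnS; apply: leq_trans le.
  by apply: ltn_sub2l => //; apply: leq_trans lt (cardT T).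
apply: (blk (S := S)) => //; split=> // T sST nT.
by case: (eqVneq T S) => // neq; case: no; exists T.
Qed.

Lemma cycle_clique (s : seq 'I_n) : uniq s -> cycle e s ->
  {in s &, forall x y, x != y -> e x y}.
Proof.
move=> us cs x y xs ys; apply: (nonseparable_clique (S := [set z in s]));
  rewrite ?inE //.
by apply: cycle_nonseparable => //; case: (s) xs.
Qed.

Lemma square_diagonal x a y b : x != y -> a != b ->
  e x a -> e a y -> e y b -> e b x -> e a b.
Proof.
move=> xy ab xa ay yb bx; have neq := neq_adj eirr.
apply: (cycle_clique (s := [:: x; a; y; b])); rewrite ?inE ?eqxx ?orbT //=.
  rewrite !inE !negb_or xy ab (neq _ _ xa) (neq _ _ ay) (neq _ _ yb).
  by rewrite eq_sym (neq _ _ bx).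
by rewrite xa ay yb bx.
Qed.

Lemma connect_in S a b : connect (within S) a b -> a \in S -> b \in S.
Proof.
case/connectP=> p + -> {b}; elim: p a => //= c p IH a /andP[/and3P[_ _ cS]].
by move=> pp _; apply: IH.
Qed.

Lemma path_exit (T : eqType) (r : rel T) (Q : pred T) u p :
  path r u p -> Q u -> ~~ Q (last u p) ->
  exists v w, [/\ v \in u :: p, w \in u :: p, r v w, Q v & ~~ Q w].
Proof.
elim: p u => [|w p IH] u /=; first by move=> _ ->.
case/andP=> uw pth Qu nQ; case Qw : (Q w).
  have [v [w' [vp wp ? ? ?]]] := IH w pth Qw nQ.
  by exists v, w'; split; rewrite // inE ?vp ?wp orbT.
by exists u, w; rewrite Qw !inE !eqxx !orbT.
Qed.

(** A simple path from [a] to [b] that avoids [x] closes up through [x] to a cycle. *)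
Lemma detour S x a b : e x a -> e x b -> a != b -> a \in S :\ x ->
  connect (within (S :\ x)) a b -> e a b.
Proof.
move=> xa xb ab aS /connectP[p0 pth0 lst0].
case/shortenP: pth0 lst0 => p pth up _ lst.
have pS : {subset a :: p <= S :\ x}.
  elim: p a aS pth {xa ab up lst} => [|c p IH] a aS /=.
    by move=> _ z; rewrite inE => /eqP ->.
  case/andP=> /and3P[_ _ cS] pth z; rewrite inE => /predU1P[->//|].
  exact: IH.
have ep : path e a p by apply: sub_path pth => u v /and3P[].
apply: (cycle_clique (s := x :: a :: p)) => //.
- rewrite cons_uniq up andbT; apply/negP => /pS.
  by rewrite !inE eqxx.
- by rewrite /= rcons_path xa ep /= -lst esym.
- by rewrite !inE eqxx orbT.
- by rewrite inE lst mem_last orbT.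
Qed.

(* Take an edge {q, c} of G[S] for which the component of c in G[S \ q] is
   smallest; that component together with q is a clique, so c is a leafy
   vertex. *)
Lemma leafy_exists S : S != set0 -> exists2 x, x \in S & leafy e S x.
Proof.
move=> S0.
pose edge (p : 'I_n * 'I_n) := [&& p.1 \in S, p.2 \in S & e p.1 p.2].
pose comp (p : 'I_n * 'I_n) := [set d | connect (within (S :\ p.1)) p.2 d].
have [p0 edge0|no] := pickP edge; last first.
  case/set0Pn: S0 => x xS; exists x => //.
  have nox a : a \in S -> e x a = false.
    by move=> aS; have := no (x, a); rewrite /edge /= xS aS.
  apply/leafyP; split; first apply/simplicialP.
    by move=> a b aS _; rewrite nox.
  by move=> a b aS _; rewrite nox.
case: (arg_minnP (fun p => #|comp p|) edge0) => -[q c] /and3P[/= qS cS qc] mn.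
have ncq : c != q by rewrite eq_sym (neq_adj eirr).
pose C := comp (q, c).
have cC : c \in C by rewrite inE.
have CS d : d \in C -> (d != q) && (d \in S).
  rewrite inE /= => /connect_in; rewrite !inE ncq cS; exact.
have Cstep d d' : d \in C -> d' \in S -> d' != q -> e d d' -> d' \in C.
  move=> dC d'S nd' dd'; have /andP[dq dS] := CS d dC.
  move: dC; rewrite !inE /= => dC; apply: connect_trans dC _.
  by apply: connect1; rewrite /= !inE dd' dq dS nd' d'S.
have CC d d' : d \in C -> d' \in C -> connect (within (S :\ q)) d d'.
  rewrite !inE /= => dC d'C; apply: connect_trans d'C.
  by rewrite within_sym.
(* Otherwise a walk inside [C] crosses an edge ab with [a] adjacent to [q] and [b] not. By [detour]
   around [a], the component of [b] in [S :\ a] avoids [q]; so it stays in [C] and misses [a],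
   against the minimality of [C]. *)
have qC d : d \in C -> e q d.
  apply: contraLR => nqd; apply/negP => dC.
  have [a [b [aC bC ab qa nqb]]] : exists a b,
      [/\ a \in C, b \in C, e a b, e q a & ~~ e q b].
    have /connectP[p pth lst] := CC c d cC dC.
    have [|a [b [ap bp /and3P[ab _ _] qa nqb]]] := path_exit pth qc.
      by rewrite -lst.
    by exists a, b; split; rewrite // inE; apply: path_connect pth _ _.
  have /andP[aq aS] := CS a aC; have /andP[bq bS] := CS b bC.
  have nba : b != a by rewrite eq_sym (neq_adj eirr).
  have nqa : q \in S :\ a by rewrite !inE eq_sym aq qS.
  case Cqb : (connect (within (S :\ a)) q b).
    by case/negP: nqb; apply: detour Cqb; rewrite // 1?esym // eq_sym.
  have DC p z : path (within (S :\ a)) z p -> z \in C ->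
      connect (within (S :\ a)) b z -> last z p \in C.
    elim: p z => //= z' p IH z /andP[zz' pth] zC bz.
    have bz' : connect (within (S :\ a)) b z'.
      by apply: connect_trans bz _; apply: connect1; exact: zz'.
    apply: IH => //; case/and3P: zz' => zz' _ /setD1P[_ z'S].
    apply: Cstep zC _ _ zz' => //; apply: contraFneq Cqb => <-.
    by rewrite within_sym.
  have := mn (a, b); rewrite /edge /= aS bS ab => /(_ isT).
  apply/negP; rewrite -ltnNge; apply: proper_card; apply/properP; split.
    apply/subsetP => z; rewrite inE /= => /connectP[p pth ->].
    exact: (DC p b).
  exists a => //; rewrite inE /=; apply/negP => /connect_in.
  by rewrite !inE nba bS eqxx => /(_ isT).
have nbC d z : d \in C -> z \in S -> e d z -> z != q -> z \in C.
  by move=> dC zS dz zq; apply: Cstep dz.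
have CCe d d' : d \in C -> d' \in C -> d != d' -> e d d'.
  move=> dC d'C ne; apply: (detour (S := S) (x := q)); rewrite ?qC //.
    by have /andP[dq dS] := CS d dC; rewrite !inE dq dS.
  exact: CC.
have simpC d : d \in C -> simplicial e S d.
  move=> dC; apply/simplicialP => a b aS bS da db ab.
  case: (eqVneq a q) => [E|aq].
    by rewrite E qC // (nbC d) // -E eq_sym.
  case: (eqVneq b q) => [->|bq]; first by rewrite esym qC // (nbC d).
  by apply: CCe; rewrite // (nbC d).
exists c => //; apply/leafyP; split; first exact: simpC.
move=> a b aS bS ca cb ab; case: (eqVneq a q) => [E|aq].
  by rewrite (simpC b) ?orbT // (nbC c) // -E eq_sym.
by rewrite (simpC a) // (nbC c).
Qed.

End BlockGraph.

(** * The greedy algorithm and its relation to co-boxicity *)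

Section Algorithm.
Variables (n : nat) (e : rel 'I_n).
Hypotheses (esym : symmetric e) (eirr : irreflexive e).
Implicit Types (S T N : {set 'I_n}) (x y z : 'I_n).

Record state := State {
  alive : {set 'I_n}; sated : {set 'I_n}; needy : {set 'I_n}; spent : nat }.

Definition rule_sated S T x := (x \in T) && simplicial e S x.
Definition rule_isolated S T x := (x \notin T) && ~~ [exists z in S, e x z].
Definition rule_twin S T N x y :=
  [&& e x y, simplicial e S x, simplicial e S y, x \notin T, x \in N & y \notin N].
Definition rule_leafy S T N x y :=
  [&& e x y, leafy e S x, simplicial e S y, x \notin T &
   ~~ [exists z in S, [&& e x z, simplicial e S z &
        ((z \in T) || ((z \in N) != (x \in N)))]]].
Definition rule_pendant S T x y :=
  [&& e x y, x \notin T & ~~ [exists z in S, e x z && (z != y)]].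

Definition step x y (st : state) : state :=
  let: State A T N k := st in
  if ~~ ((x \in A) && (y \in A)) then st
  else if rule_sated A T x then State (A :\ x) T N k
  else if rule_isolated A T x then State (A :\ x) T N (k + (x \in N))
  else if rule_twin A T N x y then State (A :\ y) T N k
  else if rule_leafy A T N x y then
    if x \in N then State (A :\ x :\ y) T N k.+1
    else State (A :\ y) T (x |: N) k
  else if rule_pendant A T x y then
    if x \in N then State (A :\ x) (y |: T) N k.+1
    else State (A :\ x) T (y |: N) k
  else st.

(** Says that the optimum of the remaining instance plus the cost spent is [c]. It is pulled back
    along the run, from the final state, where it is evident, to the initial one. *)
Definition mincost (st : state) c :=
  (exists2 P, solves e (alive st) (sated st) (needy st) P & size P + spent st <= c) /\
  (forall P, solves e (alive st) (sated st) (needy st) P -> c <= size P + spent st).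

Lemma sound_mincost S T N S' T' N' k k' c d : sound e S T N S' T' N' d ->
  k' = k + d -> mincost (State S' T' N' k') c -> mincost (State S T N k) c.
Proof.
move=> [fwd bwd] -> [[P' /bwd[P sol le] le'] mn]; split.
  by exists P => //; move: le le' => /=; lia.
move=> P0 /fwd[Q /mn /= le0 le2].
by apply: leq_trans le0 _; lia.
Qed.

Lemma step_mincost x y st c : mincost (step x y st) c -> mincost st c.
Proof.
case: st => S T N k; rewrite /step; case: ifPn => // /negPn/andP[xS yS].
case: ifPn => [/andP[xT sx]|_].
  by apply: sound_mincost; [exact: sound_touched_simplicial | rewrite addn0].
case: ifPn => [/andP[nxT /exists_inPn iso]|_].
  by apply: sound_mincost => //; apply: sound_isolated.
case: ifPn => [/and5P[xy sx sy nxT /andP[xN yN]]|_].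
  by apply: sound_mincost; [exact: (sound_twin esym eirr xS yS xy) | rewrite addn0].
case: ifPn => [/and5P[xy lx sy nxT /exists_inPn unif]|_].
  have U z : z \in S -> e x z -> simplicial e S z ->
      (z \notin T) && ((z \in N) == (x \in N)).
    by move=> zS xz sz; have := unif z zS; rewrite xz sz /= negb_or negbK.
  case: ifPn => xN.
    apply: (sound_mincost (d := 1)); last by rewrite addn1.
    apply: sound_leafy_demand => // z zS xz sz.
    by have := U z zS xz sz; rewrite xN eqb_id.
  apply: (sound_mincost (d := 0)); last by rewrite addn0.
  apply: sound_leafy_free => // z zS xz sz.
  by have := U z zS xz sz; rewrite (negPf xN) eqbF_neg.
case: ifPn => // /and3P[xy nxT /exists_inPn pend].
have P1 : {in S, forall z, e x z -> z = y}.
  by move=> z zS xz; have := pend z zS; rewrite xz /= negbK => /eqP.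
case: ifPn => xN.
  by apply: sound_mincost; [exact: sound_pendant_demand | rewrite -addn1].
by apply: sound_mincost; [exact: sound_pendant_free | rewrite addn0].
Qed.

(** The first bound gives termination; the second keeps the cost below the number of vertices, so
    that its unary form fits on the tape. *)
Definition shrinks (f : state -> state) := forall st,
  f st = st \/ #|alive (f st)| < #|alive st| /\
    spent (f st) + #|alive (f st)| <= spent st + #|alive st|.

Definition enabled x y (st : state) := [&& x \in alive st, y \in alive st &
  [|| rule_sated (alive st) (sated st) x, rule_isolated (alive st) (sated st) x,
      rule_twin (alive st) (sated st) (needy st) x y,
      rule_leafy (alive st) (sated st) (needy st) x y |
      rule_pendant (alive st) (sated st) x y]].

Lemma step_enabled x y st : enabled x y st ->
  #|alive (step x y st)| < #|alive st| /\
  spent (step x y st) + #|alive (step x y st)| <= spent st + #|alive st|.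
Proof.
case: st => S T N k; rewrite /enabled /step /= => /and3P[xS yS].
rewrite xS yS /= => rules.
have lex : #|S :\ x| < #|S| by rewrite [X in _ < X](cardsD1 x) xS.
have ley : #|S :\ y| < #|S| by rewrite [X in _ < X](cardsD1 y) yS.
have lexy : #|S :\ x :\ y| < #|S|.
  by apply: leq_ltn_trans lex; apply: subset_leq_card (subD1set _ _).
have H (A : {set 'I_n}) k' : k' <= k.+1 -> #|A| < #|S| ->
    #|A| < #|S| /\ k' + #|A| <= k + #|S|.
  by move: #|A| #|S| => i j; lia.
case: ifPn rules => [_ _|_ /=]; first exact: H.
case: ifPn => [_ _|_ /=].
  by apply: H => //=; case: (x \in N); rewrite ?addn1 ?addn0.
case: ifPn => [_ _|_ /=]; first exact: H.
case: ifPn => [_ _|_ /= ->]; first by case: ifP => _; apply: H.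
by case: ifP => _; apply: H.
Qed.

Lemma step_shrinks x y : shrinks (step x y).
Proof.
move=> st; case en : (enabled x y st); first by right; apply: step_enabled.
left; case: st en => S T N k; rewrite /enabled /step /=.
by case: (x \in S); case: (y \in S) => //=; do 5!case: ifP => //= _.
Qed.

Lemma foldl_shrinks (I : Type) (F : I -> state -> state) (l : seq I) :
  (forall i, shrinks (F i)) -> shrinks (fun st => foldl (fun s i => F i s) st l).
Proof.
move=> sh; elim: l => [|i l IH] st /=; first by left.
case: (sh i st) => [->|[lt le]]; first exact: IH.
by right; case: (IH (F i st)) => [->//|[lt' le']];
  split; [exact: ltn_trans lt' lt | exact: leq_trans le' le].
Qed.

(** Either a call before [i] has already removed a vertex, or the state is still [st] when [i]
    comes. *)
Lemma foldl_progress (I : eqType) (F : I -> state -> state) (l : seq I) i st :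
  (forall i, shrinks (F i)) -> i \in l -> #|alive (F i st)| < #|alive st| ->
  #|alive (foldl (fun s i => F i s) st l)| < #|alive st|.
Proof.
move=> sh; elim: l => //= j l IH; rewrite inE => il lt.
case: (sh j st) => [E|[lt' _]].
  by case/predU1P: il => [ij|il]; [rewrite ij E ltnn in lt | rewrite E; apply: IH].
case: (foldl_shrinks l sh (F j st)) => [->//|[lt2 _]].
exact: ltn_trans lt2 lt'.
Qed.

Definition initial := State setT set0 set0 0.

Hypothesis blk : block_graph e.

(** Take an unsated leafy vertex with a neighbour. If it has simplicial neighbours, either one is
    sated and can go, or one differs from it in being needy, which is the twin rule, or all agree,
    which is the leafy rule. If it has none, leafiness leaves a single neighbour, which is the
    pendant rule. *)
Lemma enabled_exists st : alive st != set0 -> exists x y, enabled x y st.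
Proof.
case: st => S T N k /= S0.
have [x xS lx] := leafy_exists esym eirr blk S0.
have /leafyP[sx lx'] := lx.
rewrite /enabled /=.
case xT : (x \in T); first by exists x, x; rewrite xS /rule_sated xT sx.
case nbr : [exists z in S, e x z]; last first.
  by exists x, x; rewrite xS /rule_isolated xT nbr orbT.
case: (pickP [pred z in S | e x z && simplicial e S z]) =>
    [y /and3P[yS xy sy]|nosimp].
  case: (pickP [pred z in S | [&& e x z, simplicial e S z & z \in T]]) =>
    [z /and4P[zS xz sz zT]|noT].
    by exists z, z; rewrite zS /rule_sated zT sz.
  case: (pickP [pred z in S | [&& e x z, simplicial e S z &
      (z \in N) != (x \in N)]]) => [z /and4P[zS xz sz]|noN].
    have nzT : z \notin T.
      by have := noT z; rewrite /= zS xz sz /= => ->.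
    case xN : (x \in N); case zN : (z \in N) => // _.
      exists x, z; rewrite xS zS /rule_twin xz sx sz xT xN zN /=.
      by rewrite !orbT.
    exists z, x; rewrite xS zS /rule_twin esym xz sx sz nzT zN xN /=.
    by rewrite !orbT.
  exists x, y; rewrite xS yS /rule_leafy xy lx sy xT /=.
  suff -> : [exists z in S, [&& e x z, simplicial e S z &
    (z \in T) || ((z \in N) != (x \in N))]] = false by rewrite !orbT.
  apply/negbTE/negP => /exists_inP[z zS /and3P[xz sz]].
  have := noT z; have := noN z; rewrite /= zS xz sz /= => -> ->.
  by [].
have /exists_inP[y yS xy] := nbr.
exists x, y; rewrite xS yS /rule_pendant xy xT /=.
suff -> : [exists z in S, e x z && (z != y)] = false by rewrite !orbT.
apply/negbTE/negP => /exists_inP[z zS /andP[xz zy]].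
have := nosimp z; have := nosimp y; rewrite /= zS yS xz xy /= => ny nz.
by have := lx' z y zS yS xz xy zy; rewrite ny nz.
Qed.

End Algorithm.

(** * Co-boxicity as the optimum of the covering problem *)

Section Coboxicity.
Variables (n : nat) (e : rel 'I_n).
Hypotheses (esym : symmetric e) (eirr : irreflexive e) (blk : block_graph e).
Implicit Types (u v w a b : 'I_n) (P : seq ('I_n * 'I_n)).

(* End points for the edge uv: u = [0, 0], v = [n + 2, n + 2], the other vertices
   of their block are distinct points of [1, n], the remaining neighbours of u and
   v are [1, n + 2] and [0, n + 1], and all other vertices are [0, n + 2]. *)
Definition end_lo u v w : nat :=
  if ~~ e u v then 0 else if w == u then 0 else if w == v then n.+2
  else if e u w then (if e v w then w.+1 else 1) else 0.
Definition end_hi u v w : nat :=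
  if ~~ e u v then 0 else if w == u then 0 else if w == v then n.+2
  else if e v w then (if e u w then w.+1 else n.+1) else n.+2.

Lemma end_le u v w : end_lo u v w <= end_hi u v w.
Proof.
have := ltn_ord w; rewrite /end_lo /end_hi.
by do 4!case: ifP => //=; try (case: ifP => //=); lia.
Qed.

Definition far u v a b :=
  (end_hi u v a < end_lo u v b) || (end_hi u v b < end_lo u v a).

Lemma far_adj u v a b : a != b -> far u v a b -> e a b.
Proof.
have wlog : forall a b, a != b -> end_hi u v a < end_lo u v b -> e a b.
  move=> {}a {}b ab; have lta := ltn_ord a; have ltb := ltn_ord b.
  rewrite /end_hi /end_lo; case uv : (e u v) => //=.
  case: (eqVneq a u) => [->|au].
    case: (eqVneq b u) => // bu; case: (eqVneq b v) => [->//|bv].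
    by case ub : (e u b).
  case: (eqVneq a v) => [_|av].
    case: (eqVneq b u) => // bu; case: (eqVneq b v) => [_|bv]; first lia.
    by case: (e u b); case: (e v b); lia.
  case: (eqVneq b u) => // bu; case: (eqVneq b v) => [->|bv].
    by case va : (e v a); rewrite ?ltnn // [e a v]esym va.
  case ub : (e u b); last by rewrite ltn0.
  have lo_le : (if e v b then b.+1 else 1) <= n.+1 by case: ifP => // _; apply: ltnW.
  case va : (e v a); last by rewrite ltnNge leqW.
  case ua : (e u a); last by rewrite ltnNge lo_le.
  case vb : (e v b) => //.
  (* The case that rests on the block structure: [a] and [b] are distinct common neighbours of [u]
     and [v], so they close a 4-cycle with them. *)
  move=> _; apply: (square_diagonal esym eirr blk (x := u) (y := v)) => //.
  - exact: neq_adj.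
  - by rewrite esym.
  - by rewrite esym.
move=> ab /orP[]; first exact: wlog.
by rewrite esym; apply: wlog; rewrite eq_sym.
Qed.

Lemma touched_far u v b : e u v -> b != u -> e u b -> far u v u b.
Proof.
move=> uv bu ub; rewrite /far; apply/orP; left.
rewrite /end_hi /end_lo uv eqxx (negPf bu) ub /=.
by case: eqP => // _; case: ifP.
Qed.

Lemma touched_far' u v b : e u v -> b != v -> e v b -> far u v v b.
Proof.
move=> uv bv vb; rewrite /far; apply/orP; right.
have ltb := ltn_ord b.
rewrite /end_hi /end_lo uv eqxx (negPf bv) vb /=.
have -> : (v == u) = false by apply/negP => /eqP E; rewrite E eirr in uv.
by case: eqP => // _; case: ifP => _; lia.
Qed.

Lemma spans_far u v a b : a != b -> spans e a b (u, v) -> far u v a b.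
Proof.
move=> ab /and5P[/= uv au av bu bv].
have N x y : e x y -> (x == y) = false.
  by move=> xy; apply: negbTE; exact: neq_adj xy.
rewrite /far /end_hi /end_lo uv !N // ![e u _]esym ![e v _]esym au av bu bv /=.
by rewrite !ltnS -neq_ltn; apply: ab.
Qed.

(* Loops carry no interval graph; they are completed to edges when possible. *)
Definition unloop (p : 'I_n * 'I_n) :=
  if p.1 == p.2 then (p.1, odflt p.1 [pick w | e p.1 w]) else p.

Lemma solves_far P a b : solves e setT set0 set0 P -> e a b ->
  exists2 p, p \in map unloop P & far p.1 p.2 a b.
Proof.
move=> [ok _ c] ab; have nab := neq_adj eirr ab.
have T p x y : p \in P -> touches p x -> e x y -> far (unloop p).1 (unloop p).2 x y.
  move=> pP px xy; have /and3P[_ _] := allP ok p pP.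
  have nyx : y != x by rewrite eq_sym (neq_adj eirr).
  rewrite /unloop; case: eqVneq => [E _|ne /= pe] /=.
    have -> : p.1 = x by move: px; rewrite /touches -E orbb => /eqP.
    case: pickP => [w xw|/(_ y)] /=; last by rewrite xy.
    exact: touched_far.
  case/orP: px => /eqP F; rewrite F in pe *; first exact: touched_far.
  exact: touched_far'.
have := c a b (in_setT _) (in_setT _) ab; rewrite /covered !inE /=.
case/or3P => [/hasP[p pP pa]|/hasP[p pP pb]|/hasP[p pP sp]].
- by exists (unloop p); [exact: map_f | exact: T].
- exists (unloop p); first exact: map_f.
  by rewrite /far orbC; apply: T; rewrite // esym.
- exists (unloop p); first exact: map_f.
  have np : (p.1 == p.2) = false.
    by apply: negbTE; apply: (neq_adj eirr); case/and5P: sp.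
  by rewrite /unloop np; apply: spans_far => //; case: (p) sp.
Qed.

Lemma INR_leq (i j : nat) : Rle (INR i) (INR j) <-> i <= j.
Proof.
split=> [/INR_le|/leP]; first by move/leP.
exact: le_INR.
Qed.

Lemma solves_box_rep P : solves e setT set0 set0 P ->
  box_rep (complement e) (size P).
Proof.
(* A default for [nth] requires a vertex; without vertices there are no boxes to give. *)
move=> sol; case: (posnP n) => [n0|n_gt0].
  exists (fun _ _ => INR 0), (fun _ _ => INR 0); split=> [v|u]; exfalso.
    by have := ltn_ord v; rewrite {2}n0.
  by have := ltn_ord u; rewrite {2}n0.
pose z : 'I_n := Ordinal n_gt0.
pose p i := nth (z, z) (map unloop P) i.
exists (fun v i => INR (end_lo (p i).1 (p i).2 v)),
       (fun v i => INR (end_hi (p i).1 (p i).2 v)); split=> [v i _|a b ab].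
  by apply/INR_leq; apply: end_le.
have farE i : ~~ far (p i).1 (p i).2 a b <->
    Rle (INR (end_lo (p i).1 (p i).2 a)) (INR (end_hi (p i).1 (p i).2 b)) /\
    Rle (INR (end_lo (p i).1 (p i).2 b)) (INR (end_hi (p i).1 (p i).2 a)).
  rewrite /far negb_or -!leqNgt; split=> [/andP[? ?]|[/INR_leq-> /INR_leq->]] //.
  by split; apply/INR_leq.
split=> [/andP[_ nab] i ltP|H].
  by apply/farE; apply: contra nab; apply: far_adj.
rewrite /complement ab /=; apply/negP => /(solves_far sol)[q /(nthP (z, z))].
rewrite size_map => -[i ltP <-] fr.
by have /farE := H i ltP; rewrite fr.
Qed.

Lemma argmin_R (f : 'I_n -> R) : 0 < n -> exists u, forall v, Rle (f u) (f v).
Proof.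
move=> n_gt0.
suff H (s : seq 'I_n) : s != [::] -> exists u, forall v, v \in s -> Rle (f u) (f v).
  have [|u mn] := H (enum 'I_n).
    by rewrite -size_eq0 size_enum_ord -lt0n.
  by exists u => v; apply: mn; rewrite mem_enum.
elim: s => // x s IH _; case: (eqVneq s [::]) => [->|/IH[u mn]].
  by exists x => v; rewrite inE => /eqP ->; apply: Rle_refl.
case: (Rle_dec (f x) (f u)) => [le|nle].
  exists x => v; rewrite inE => /predU1P[->|/mn]; first exact: Rle_refl.
  exact: Rle_trans.
exists u => v; rewrite inE => /predU1P[->|/mn] //.
by apply: Rlt_le; apply: Rnot_le_lt.
Qed.

Lemma box_rep_solves d : box_rep (complement e) d ->
  exists2 P, solves e setT set0 set0 P & size P <= d.
Proof.
move=> [lo [hi [lohi rep]]].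
pose apart i a b := Rlt (hi a i) (lo b i).
have apart_adj i a b : i < d -> apart i a b -> e a b.
  move=> ltd ap; have nab : a != b.
    apply/eqP => E; apply: (Rlt_irrefl (hi a i)).
    by apply: Rlt_le_trans ap _; rewrite -E; apply: lohi.
  apply: contraT => ne; have : complement e a b by rewrite /complement nab.
  move/(rep a b nab)/(_ i ltd) => [_ le]; exfalso.
  by apply: (Rlt_irrefl (hi a i)); apply: Rlt_le_trans ap le.
have adj_apart a b : e a b -> exists2 i, i < d & apart i a b \/ apart i b a.
  move=> ab; have nab := neq_adj eirr ab.
  apply: NNPP => no; have : complement e a b.
    apply/(rep a b nab) => i ltd; split; apply: Rnot_lt_le => lt; apply: no.
      by exists i => //; right.
    by exists i => //; left.
  by rewrite /complement ab andbF.
(* Each coordinate contributes one pair, namely its two extremal vertices, or none if all its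
   intervals meet. *)
have K k : k <= d -> exists P, [/\ all (pair_in e setT) P, size P <= k &
   forall i a b, i < k -> apart i a b -> covered e set0 P a b].
  elim: k => [|k IH] ltk; first by exists [::].
  have [P [ok sz cov]] := IH (ltnW ltk).
  have [[a0 [b0 ap0]]|no] := classic (exists a b, apart k a b); last first.
    exists P; split=> //; first exact: leqW.
    move=> i a b; rewrite ltnS leq_eqVlt => /predU1P[->|lt] ap.
      by case: no; exists a, b.
    exact: cov ap.
  have n_gt0 : 0 < n by apply: leq_ltn_trans (ltn_ord a0).
  have [u mnu] := argmin_R (hi^~ k) n_gt0.
  have [v mxv] := argmin_R (fun w => Ropp (lo w k)) n_gt0.
  have {}mxv w : Rle (lo w k) (lo v k) by apply: Ropp_le_cancel.
  have apu a b : apart k a b -> apart k u b.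
    by move=> ap; apply: Rle_lt_trans ap; apply: mnu.
  have apv a b : apart k a b -> apart k a v.
    by move=> ap; apply: Rlt_le_trans ap _; apply: mxv.
  have adj a b : apart k a b -> e a b by apply: apart_adj.
  have uv : e u v := adj _ _ (apv _ _ (apu _ _ ap0)).
  exists ((u, v) :: P); split=> //.
    by rewrite /= ok /pair_in /= !in_setT uv orbT.
  move=> i a b; rewrite ltnS leq_eqVlt => /predU1P[->|lt] ap; last first.
    by apply: covered_cons; apply: cov ap.
  have ab := adj _ _ ap; have ub := adj _ _ (apu _ _ ap).
  have av := adj _ _ (apv _ _ ap).
  rewrite /covered /touched /= /touches /=.
  case: (eqVneq u a) => [_|nua]; first by rewrite !orbT.
  case: (eqVneq v b) => [_|nvb]; first by rewrite !orbT.
  suff -> : spans e a b (u, v) by rewrite !orbT.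
  have nE := neq_adj eirr.
  (* The two adjacencies still missing are the diagonals of the 4-cycle u - b - a - v - u. *)
  rewrite /spans /= uv av [e b u]esym ub /=; apply/andP; split.
    by apply: (@square_diagonal _ _ esym eirr blk b a v u);
      rewrite // 1?esym // eq_sym.
  by apply: (@square_diagonal _ _ esym eirr blk u b a v);
    rewrite // 1?esym // eq_sym.
have [P [ok sz cov]] := K d (leqnn d).
exists P => //; split=> // [v _|a b _ _ /adj_apart[i lt [ap|ap]]].
- by rewrite inE.
- exact: cov ap.
- by rewrite coveredC; apply: cov ap.
Qed.

Lemma mincost_coboxicity k : mincost e (initial n) k -> coboxicity_is e k.
Proof.
move=> [[P sol le] mn]; rewrite /= addn0 in le.
have szP : size P = k.
  by apply/eqP; rewrite eqn_leq le /=; have := mn P sol; rewrite /= addn0.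
split; first by rewrite -szP; apply: solves_box_rep.
move=> d /box_rep_solves[Q solQ leQ].
by have := mn Q solQ; rewrite /= addn0 => /leq_trans; apply.
Qed.

End Coboxicity.

(** * Implementation *)

Definition FOr phi psi := FNot (FAnd (FNot phi) (FNot psi)).
Definition FXor phi psi := FOr (FAnd phi (FNot psi)) (FAnd psi (FNot phi)).
Definition FExA x phi := FEx x (FAnd (FIn t_alive x) phi).

(** The names of the bound variables are arguments, since every variable is one track and nested
    quantifiers must use different ones. Variables 0 and 1 belong to the loops of [main]. *)
Definition f_simplicial x a b := FNot (FExA a (FExA b
  (FAnd (FAdj x a) (FAnd (FAdj x b) (FAnd (FNot (FEq a b)) (FNot (FAdj a b))))))).
Definition f_leafy x a b c d := FAnd (f_simplicial x a b) (FNot (FExA a (FExA b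
  (FAnd (FAdj x a) (FAnd (FAdj x b) (FAnd (FNot (FEq a b))
    (FAnd (FNot (f_simplicial a c d)) (FNot (f_simplicial b c d))))))))).

Definition f_sated := FAnd (FIn t_sated 0) (f_simplicial 0 3 4).
Definition f_isolated := FAnd (FNot (FIn t_sated 0)) (FNot (FExA 2 (FAdj 0 2))).
Definition f_twin := FAnd (FAdj 0 1) (FAnd (f_simplicial 0 3 4)
  (FAnd (f_simplicial 1 3 4) (FAnd (FNot (FIn t_sated 0))
  (FAnd (FIn t_needy 0) (FNot (FIn t_needy 1)))))).
Definition f_leafy_rule := FAnd (FAdj 0 1) (FAnd (f_leafy 0 3 4 5 6)
  (FAnd (f_simplicial 1 3 4) (FAnd (FNot (FIn t_sated 0))
  (FNot (FExA 2 (FAnd (FAdj 0 2) (FAnd (f_simplicial 2 3 4)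
    (FOr (FIn t_sated 2) (FXor (FIn t_needy 2) (FIn t_needy 0)))))))))).
Definition f_pendant := FAnd (FAdj 0 1) (FAnd (FNot (FIn t_sated 0))
  (FNot (FExA 2 (FAnd (FAdj 0 2) (FNot (FEq 2 1)))))).

Definition Cond phi p q := Seq (eval 0 phi) (If (BVar (flag 0)) p q).
Definition kill x := Assign t_alive (BAnd (BVar t_alive) (BNot (BVar (var x)))).
Definition mark t x := Assign t (BOr (BVar t) (BVar (var x))).
(** The cost is kept in unary: adding one is a shift, and the track is already the output. *)
Definition spend := Shift t_out true.

Definition body :=
  Cond (FAnd (FIn t_alive 0) (FIn t_alive 1))
  (Cond f_sated (kill 0)
  (Cond f_isolated (Seq (Cond (FIn t_needy 0) spend Skip) (kill 0))
  (Cond f_twin (kill 1)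
  (Cond f_leafy_rule
    (Cond (FIn t_needy 0) (Seq (kill 0) (Seq (kill 1) spend))
      (Seq (kill 1) (mark t_needy 0)))
  (Cond f_pendant
    (Cond (FIn t_needy 0) (Seq (kill 0) (Seq (mark t_sated 1) spend))
      (Seq (kill 0) (mark t_needy 1)))
  Skip))))) Skip.

(* The side of the matrix is the k such that position k^2 - 1, i.e. row and
   column k - 1 of a matrix with k columns, is the last cell of the input. *)
Definition find_last :=
  For t_count (Seq (init t_row) (Seq (init t_col) (Seq
    (For t_pos (Seq (Assign (flag 0) (BNot BTrue)) (Seq
      (If (BAnd (BVar t_row) (BVar t_count))
        (If (BAnd (BVar t_col) (BVar t_count)) (Assign (flag 0) BTrue) Skip)
        Skip)
      (odometer t_count))))
    (If (BVar (flag 0)) (Assign t_last (BVar t_count)) Skip)))).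

(** The row indices met during one pass over the matrix are exactly the vertices. *)
Definition set_alive := Seq (init t_row) (Seq (init t_col)
  (For t_pos (Seq (Assign t_alive (BOr (BVar t_alive) (BVar t_row)))
    (odometer t_last)))).

Definition main := Seq find_last (Seq set_alive
  (For t_count (For (var 0) (For (var 1) body)))).

(* 100 exceeds the numbers of all tracks in use. *)
Lemma wf_main : wf 100 main.
Proof. by vm_compute. Qed.

(** * Correctness of the implementation *)

Section Correctness.
Variables (n : nat) (e : rel 'I_n).
Hypotheses (n_gt0 : 0 < n).
Let L := n * n.
Implicit Types (S T N : {set 'I_n}) (x y z : 'I_n) (s : store).

Let L_gt0 : 0 < L. Proof. by rewrite /L muln_gt0 n_gt0. Qed.
Let n_leL : n <= L. Proof. by rewrite /L leq_pmull. Qed.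

Definition mem_nat S p := [exists x in S, val x == p].

Lemma mem_natE S x : mem_nat S x = (x \in S).
Proof.
apply/exists_inP/idP => [[z zS /eqP/val_inj <-]//|xS].
by exists x.
Qed.

Lemma mem_nat_lt S p : mem_nat S p -> p < n.
Proof. by case/exists_inP => z _ /eqP <-; apply: ltn_ord. Qed.

Lemma mem_natD1 S x p : mem_nat (S :\ x) p = mem_nat S p && (p != x).
Proof.
apply/exists_inP/andP => [[z /setD1P[zx zS] /eqP <-]|[/exists_inP[z zS /eqP <-] zx]].
  by rewrite mem_natE zS.
by exists z; rewrite // !inE zS andbT.
Qed.

Lemma mem_natU1 S x p : mem_nat (x |: S) p = mem_nat S p || (p == x).
Proof.
apply/exists_inP/orP => [[z /setU1P[->|zS] /eqP <-]|[/exists_inP[z zS zp]|/eqP->]].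
- by right.
- by left; rewrite mem_natE.
- by exists z; rewrite // !inE zS orbT.
- by exists x; rewrite // !inE eqxx.
Qed.

Definition represents s (st : state n) :=
  [/\ s t_last =1 pred1 n.-1 /\ (forall x y, s t_graph (x * n + y) = e x y),
      s t_alive =1 mem_nat (alive st), s t_sated =1 mem_nat (sated st),
      s t_needy =1 mem_nat (needy st) & s t_out =1 (fun p => p < spent st)].

Lemma eq_represents s s' st : {in persistent, forall t, s' t = s t} ->
  represents s st -> represents s' st.
Proof.
by move=> E [[la g] al sa ne ou]; rewrite /represents !E // ?inE ?eqxx ?orbT.
Qed.

Section Formulas.
Variables (s : store) (st : state n).
Hypothesis rep : represents s st.
Implicit Types (rho : nat -> nat).

Lemma holds_sated rho v x : rho v = x ->
  holds L n s rho (FIn t_sated v) = (x \in sated st).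
Proof. by case: rep => _ _ sa _ _ /= ->; rewrite sa mem_natE. Qed.

Lemma holds_needy rho v x : rho v = x ->
  holds L n s rho (FIn t_needy v) = (x \in needy st).
Proof. by case: rep => _ _ _ ne _ /= ->; rewrite ne mem_natE. Qed.

Lemma holds_eq rho u v x y : rho u = x -> rho v = y ->
  holds L n s rho (FEq u v) = (x == y).
Proof. by move=> /= -> ->. Qed.

Lemma holds_adj rho u v x y : rho u = x -> rho v = y ->
  holds L n s rho (FAdj u v) = e x y.
Proof.
by case: rep => [[_ g] _ _ _ _] /= -> ->; rewrite !ltn_ord g.
Qed.

Lemma holds_exA rho v phi (Q : pred 'I_n) :
  (forall x, holds L n s (bind rho v x) phi = Q x) ->
  holds L n s rho (FExA v phi) = [exists x in alive st, Q x].
Proof.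
move=> H; case: rep => _ al _ _ _.
apply/hasP/exists_inP => [[i _ /= /andP[]]|[x xS Qx]].
  rewrite {1}/bind eqxx al => iS; have lt := mem_nat_lt iS.
  by move=> Qi; exists (Ordinal lt); [rewrite -mem_natE | rewrite -H].
exists (x : nat); first by rewrite mem_iota /= add0n (leq_trans (ltn_ord x)).
by rewrite /= {1}/bind eqxx al mem_natE xS; move: Qx; rewrite -H.
Qed.

Lemma holds_not rho phi b : holds L n s rho phi = b ->
  holds L n s rho (FNot phi) = ~~ b.
Proof. by move=> /= ->. Qed.

Lemma holds_and rho phi psi b c : holds L n s rho phi = b ->
  holds L n s rho psi = c -> holds L n s rho (FAnd phi psi) = b && c.
Proof. by move=> /= -> ->. Qed.

Lemma holds_simplicial rho v a b x : rho v = x -> v != a -> v != b -> a != b ->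
  holds L n s rho (f_simplicial v a b) = simplicial e (alive st) x.
Proof.
move=> vx va vb ab; apply: holds_not; apply: holds_exA => y; apply: holds_exA => z.
have E1 : bind (bind rho a y) b z v = x by rewrite /bind (negPf va) (negPf vb).
have E2 : bind (bind rho a y) b z a = y by rewrite /bind eqxx (negPf ab).
have E3 : bind (bind rho a y) b z b = z by rewrite /bind eqxx.
apply: holds_and; first exact: holds_adj.
apply: holds_and; first exact: holds_adj.
apply: holds_and; first by apply: holds_not; apply: holds_eq.
by apply: holds_not; apply: holds_adj.
Qed.

Variables (x y : 'I_n) (rho : nat -> nat).
Hypotheses (rho0 : rho 0 = x) (rho1 : rho 1 = y).

Lemma holds_leafy0 : holds L n s rho (f_leafy 0 3 4 5 6) = leafy e (alive st) x.
Proof.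
apply: holds_and; first exact: holds_simplicial.
apply: holds_not; apply: holds_exA => a; apply: holds_exA => b.
apply: holds_and; first exact: holds_adj.
apply: holds_and; first exact: holds_adj.
apply: holds_and; first by apply: holds_not; apply: holds_eq.
by apply: holds_and; apply: holds_not; apply: holds_simplicial.
Qed.

Lemma holds_sated_rule :
  holds L n s rho f_sated = rule_sated e (alive st) (sated st) x.
Proof.
by apply: holds_and; [exact: holds_sated | exact: holds_simplicial].
Qed.

Lemma holds_isolated_rule :
  holds L n s rho f_isolated = rule_isolated e (alive st) (sated st) x.
Proof.
apply: holds_and; first by apply: holds_not; apply: holds_sated.
by apply: holds_not; apply: holds_exA => z; apply: holds_adj.
Qed.

Lemma holds_twin_rule : holds L n s rho f_twin =
  rule_twin e (alive st) (sated st) (needy st) x y.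
Proof.
apply: holds_and; first exact: holds_adj.
apply: holds_and; first exact: holds_simplicial.
apply: holds_and; first exact: holds_simplicial.
apply: holds_and; first by apply: holds_not; apply: holds_sated.
apply: holds_and; first exact: holds_needy.
by apply: holds_not; apply: holds_needy.
Qed.

Lemma holds_leafy_rule : holds L n s rho f_leafy_rule =
  rule_leafy e (alive st) (sated st) (needy st) x y.
Proof.
apply: holds_and; first exact: holds_adj.
apply: holds_and; first exact: holds_leafy0.
apply: holds_and; first exact: holds_simplicial.
apply: holds_and; first by apply: holds_not; apply: holds_sated.
apply: holds_not; apply: holds_exA => z.
apply: holds_and; first exact: holds_adj.
apply: holds_and; first exact: holds_simplicial.
set r := bind _ _ _.
have := @holds_sated r 2 z erefl; have := @holds_needy r 2 z erefl.
have := @holds_needy r 0 x rho0; cbn [holds FOr FXor] => -> -> ->.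
by case: (z \in needy st); case: (x \in needy st); case: (z \in sated st).
Qed.

Lemma holds_pendant_rule : holds L n s rho f_pendant =
  rule_pendant e (alive st) (sated st) x y.
Proof.
apply: holds_and; first exact: holds_adj.
apply: holds_and; first by apply: holds_not; apply: holds_sated.
apply: holds_not; apply: holds_exA => z.
apply: holds_and; first exact: holds_adj.
by apply: holds_not; apply: holds_eq.
Qed.

End Formulas.

Definition places s i j := s (var 0) =1 pred1 i /\ s (var 1) =1 pred1 j.

(** Evaluating a query writes to scratch tracks only, so both branches start in a store that agrees
    with [s] on the persistent tracks. [Q] is arbitrary in order to admit further code after the
    conditional. *)
Lemma den_cond phi p q s i j (Q : store -> Prop) : scoped [:: 0; 1] phi ->
  s t_last =1 pred1 n.-1 -> places s i j -> i < L -> j < L ->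
  (forall s', {in persistent, forall t, s' t = s t} -> places s' i j ->
    if holds L n s (fun v => if v == 0 then i else j) phi then Q (den L p s')
    else Q (den L q s')) ->
  Q (den L (Cond phi p q) s).
Proof.
move=> c la [p0 p1] iL jL H; rewrite /Cond den_seq.
have as_ : assigns L s [:: 0; 1] (fun v => if v == 0 then i else j).
  by move=> v; rewrite !inE => /orP[] /eqP ->.
have E := evalP n_gt0 erefl 0 c as_ la.
set s' := den _ _ _ in E *.
have K t : keeps [:: 0; 1] 0 t -> s' t = s t by apply: eval_frame.
have := H s'; rewrite [den L (If _ _ _) _]/= (some_flag L_gt0 E).
have pl : places s' i j.
  by split=> u; rewrite K ?keeps_var.
move=> {}H; have := H _ pl; case: ifP => _; apply => t tp.
all: by apply: K; rewrite /keeps tp.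
Qed.

Lemma represents_kill s st x v : represents s st -> s (var v) =1 pred1 (x : nat) ->
  represents (den L (kill v) s)
    (State (alive st :\ x) (sated st) (needy st) (spent st)).
Proof.
move=> [[la g] al sa ne ou] sv; split=> //= p.
by rewrite updE /= al sv mem_natD1.
Qed.

Lemma represents_mark_needy s st x v : represents s st ->
  s (var v) =1 pred1 (x : nat) ->
  represents (den L (mark t_needy v) s)
    (State (alive st) (sated st) (x |: needy st) (spent st)).
Proof.
move=> [[la g] al sa ne ou] sv; split=> //= p.
by rewrite updE /= ne sv mem_natU1 -negb_or negbK.
Qed.

Lemma represents_mark_sated s st x v : represents s st ->
  s (var v) =1 pred1 (x : nat) ->
  represents (den L (mark t_sated v) s)
    (State (alive st) (x |: sated st) (needy st) (spent st)).
Proof.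
move=> [[la g] al sa ne ou] sv; split=> //= p.
by rewrite updE /= sa sv mem_natU1 -negb_or negbK.
Qed.

Lemma represents_spend s st : represents s st ->
  represents (den L spend s)
    (State (alive st) (sated st) (needy st) (spent st).+1).
Proof.
move=> [[la g] al sa ne ou]; split=> //= p.
by rewrite updE; case: p => // p; rewrite ou.
Qed.

(** The loops run over all tape positions; those that are not vertices are never alive, and the
    outer test of [body] makes them idle. *)
Definition step_nat i j st :=
  if insub i is Some x then if insub j is Some y then step e x y st else st
  else st.

Lemma body_correct s st i j : i < L -> j < L -> places s i j ->
  represents s st -> represents (den L body s) (step_nat i j st).
Proof.
move=> iL jL pl rep.
have cond phi p q s0 (Q : store -> Prop) : scoped [:: 0; 1] phi ->
    represents s0 st -> places s0 i j ->
    (forall s', represents s' st -> places s' i j ->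
    if holds L n s0 (fun v => if v == 0 then i else j) phi then Q (den L p s')
    else Q (den L q s')) ->
    Q (den L (Cond phi p q) s0).
  move=> c rep0 pl0 H; apply: (den_cond c _ pl0) => //; first by case: rep0 => [[]].
  move=> s' E; apply: H; exact: eq_represents rep0.
have condr phi p q s0 st' : scoped [:: 0; 1] phi ->
    represents s0 st -> places s0 i j ->
    (forall s', represents s' st -> places s' i j ->
    if holds L n s0 (fun v => if v == 0 then i else j) phi
    then represents (den L p s') st' else represents (den L q s') st') ->
    represents (den L (Cond phi p q) s0) st'.
  exact: (cond _ _ _ _ (fun s' => represents s' st')).
apply: (condr) => // s1 rep1 pl1; cbn [holds].
have -> : s t_alive i = mem_nat (alive st) i by case: rep.
have -> : s t_alive j = mem_nat (alive st) j by case: rep.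
rewrite /step_nat; case: insubP => [x _ xi|ni]; last first.
  rewrite (_ : mem_nat _ i = false) //; apply: contraNF ni; exact: mem_nat_lt.
case: insubP => [y _ yj|nj]; last first.
  rewrite andbC (_ : mem_nat _ j = false) //; apply: contraNF nj; exact: mem_nat_lt.
subst i j; rewrite !mem_natE /step.
case: st rep rep1 cond condr => A T N k rep rep1 cond condr; rewrite [alive _]/=.
case xyA: ((x \in A) && (y \in A)); rewrite [~~ _]/= //; cbv iota.
pose rho v : nat := if v == 0 then x : nat else y.
have rho0 : rho 0 = x by []. have rho1 : rho 1 = y by [].
have pK0 s' : places s' x y -> s' (var 0) =1 pred1 (x : nat) by case.
have pK1 s' : places s' x y -> s' (var 1) =1 pred1 (y : nat) by case.
rewrite -/rho in cond condr.
apply: (condr f_sated _ _ _ _ isT rep1 pl1) => s2 rep2 pl2.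
rewrite (holds_sated_rule rep1 rho0 : _ = rule_sated e A T x).
case: (rule_sated e A T x).
  exact: (represents_kill rep2 (pK0 _ pl2)).
apply: (condr f_isolated _ _ _ _ isT rep2 pl2) => s3 rep3 pl3.
rewrite (holds_isolated_rule rep2 rho0 : _ = rule_isolated e A T x).
case: (rule_isolated e A T x).
  rewrite den_seq.
  apply: (cond (FIn t_needy 0) _ _ s3 (fun s' => represents (den L (kill 0) s') _)
    isT rep3 pl3) => s4 rep4 pl4.
  rewrite (holds_needy rep3 rho0 : _ = (x \in N)); case: (x \in N).
    rewrite (addn1 k); apply: (represents_kill (represents_spend rep4) (x := x)).
    by case: pl4.
  by rewrite (addn0 k); apply: (represents_kill rep4 (pK0 _ pl4)).
apply: (condr f_twin _ _ _ _ isT rep3 pl3) => s4 rep4 pl4.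
rewrite (holds_twin_rule rep3 rho0 rho1 : _ = rule_twin e A T N x y).
case: (rule_twin e A T N x y).
  exact: (represents_kill rep4 (pK1 _ pl4)).
apply: (condr f_leafy_rule _ _ _ _ isT rep4 pl4) => s5 rep5 pl5.
rewrite (holds_leafy_rule rep4 rho0 rho1 : _ = rule_leafy e A T N x y).
case: (rule_leafy e A T N x y).
  apply: (condr (FIn t_needy 0) _ _ _ _ isT rep5 pl5) => s6 rep6 pl6.
  rewrite (holds_needy rep5 rho0 : _ = (x \in N)); case: (x \in N); rewrite !den_seq.
    apply: (represents_spend (st := State _ _ _ _)).
    apply: (represents_kill (st := State _ _ _ _) (x := y)); last by case: pl6.
    exact: (represents_kill rep6 (pK0 _ pl6)).
  apply: (represents_mark_needy (st := State _ _ _ _) (x := x));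
    last by case: pl6.
  exact: (represents_kill rep6 (pK1 _ pl6)).
apply: (condr f_pendant _ _ _ _ isT rep5 pl5) => s6 rep6 pl6.
rewrite (holds_pendant_rule rep5 rho0 rho1 : _ = rule_pendant e A T x y).
case: (rule_pendant e A T x y);  last exact: rep6.
apply: (condr (FIn t_needy 0) _ _ _ _ isT rep6 pl6) => s7 rep7 pl7.
rewrite (holds_needy rep6 rho0 : _ = (x \in N)); case: (x \in N); rewrite !den_seq.
  apply: (represents_spend (st := State _ _ _ _)).
  apply: (represents_mark_sated (st := State _ _ _ _) (x := y)); last by case: pl7.
  exact: (represents_kill rep7 (pK0 _ pl7)).
apply: (represents_mark_needy (st := State _ _ _ _) (x := y)); last by case: pl7.
exact: (represents_kill rep7 (pK0 _ pl7)).
Qed.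

Lemma foldl_iotaS (T : Type) (f : T -> nat -> T) (a : T) m :
  foldl f a (iota 0 m.+1) = f (foldl f a (iota 0 m)) m.
Proof. by rewrite -addn1 iotaD foldl_cat. Qed.

Lemma represents_upd s st r f : r \notin persistent ->
  represents s st -> represents (upd s r f) st.
Proof.
move=> nr; apply: eq_represents => t tp; rewrite updN //.
by apply: contraNneq nr => <-.
Qed.

Definition scan st := foldl (fun st i =>
  foldl (fun st j => step_nat i j st) st (iota 0 L)) st (iota 0 L).

Lemma body_var0 : var 0 \notin writes body.
Proof. by vm_compute. Qed.

Lemma inner_correct s st i : i < L -> s (var 0) =1 pred1 i -> represents s st ->
  represents (den L (For (var 1) body) s)
    (foldl (fun st j => step_nat i j st) st (iota 0 L)).
Proof.
move=> iL s0 rep.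
have [||s' [rep' _] ->] := @den_for (fun m s' =>
    represents s' (foldl (fun st j => step_nat i j st) st (iota 0 m)) /\
    s' (var 0) =1 pred1 i) L (var 1) body s; [by split | | exact: represents_upd].
move=> m s1 mL [rep1 v1]; rewrite foldl_iotaS; split.
  by apply: body_correct.
by rewrite den_frame ?body_var0 // updN.
Qed.

Lemma scan_correct s st : represents s st ->
  represents (den L (For (var 0) (For (var 1) body)) s) (scan st).
Proof.
move=> rep.
have [||s' rep' ->] := @den_for (fun m s' => represents s' (foldl (fun st i =>
    foldl (fun st j => step_nat i j st) st (iota 0 L)) st (iota 0 m)))
  L (var 0) (For (var 1) body) s; [by [] | | exact: represents_upd].
move=> m s1 mL rep1; rewrite foldl_iotaS; by apply: inner_correct.
Qed.

Definition scans m := iter m scan (initial n).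

Lemma loops_correct s : represents s (initial n) ->
  represents (den L (For t_count (For (var 0) (For (var 1) body))) s) (scans L).
Proof.
move=> rep.
have [||s' rep' ->] := @den_for (fun m s' => represents s' (scans m))
  L t_count (For (var 0) (For (var 1) body)) s; [by [] | | exact: represents_upd].
by move=> m s1 mL rep1; apply: scan_correct; apply: represents_upd.
Qed.

Lemma find_last_frame s t : t \in persistent -> t != t_last ->
  den L find_last s t = s t.
Proof.
move=> tp tl; apply: den_frame; apply: contraNN tl => w.
have H : all (fun t => (t \in persistent) ==> (t == t_last)) (writes find_last).
  by vm_compute.
by have := allP H t w; rewrite tp.
Qed.

Lemma last_position c : (L.-1 %/ c.+1 == c) && (L.-1 %% c.+1 == c) = (c == n.-1).
Proof.
apply/andP/eqP => [[/eqP d /eqP m]|->].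
  have := divn_eq L.-1 c.+1; rewrite d m => E.
  have : n * n = c.+1 * c.+1 by rewrite -/L; move: L_gt0 E; nia.
  by move=> sq; nia.
have -> : L.-1 = n.-1 * n + n.-1 by rewrite /L; nia.
by rewrite prednK // divnMDl // modnMDl divn_small ?modn_small ?addn0 ?eqxx // prednK.
Qed.

Lemma find_last_correct s : s t_last =1 pred0 ->
  den L find_last s t_last =1 pred1 n.-1.
Proof.
move=> s0; set inner := Seq (Assign (flag 0) (BNot BTrue)) (Seq
  (If (BAnd (BVar t_row) (BVar t_count))
    (If (BAnd (BVar t_col) (BVar t_count)) (Assign (flag 0) BTrue) Skip) Skip)
  (odometer t_count)).
pose I c (s' : store) := s' t_last =1 (fun p => (p == n.-1) && (n.-1 < c)).
have [||s' Is' E] := @den_for I L t_count (Seq (init t_row) (Seq (init t_col) (Seq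
    (For t_pos inner)
    (If (BVar (flag 0)) (Assign t_last (BVar t_count)) Skip)))) s.
- by move=> p; rewrite s0 /= andbF.
- move=> c s1 cL I1; rewrite 3!den_seq; set s2 := upd s1 _ _.
  (* The flag is rewritten in every round, so after [m] rounds it speaks of position [m.-1]; before
     the first round its value is arbitrary. *)
  pose J m (s' : store) := [/\ s' t_row =1 pred1 (m %/ c.+1),
    s' t_col =1 pred1 (m %% c.+1), s' t_count =1 pred1 c,
    forall p, s' (flag 0) p =
      (0 < m) && ((m.-1 %/ c.+1 == c) && (m.-1 %% c.+1 == c)) \/ m = 0 &
    s' t_last = s1 t_last].
  set s3 := den L (init t_col) _.
  have [||s4 [_ _ cnt4 f4 last4] ->] := @den_for J L t_pos inner s3.
  + split.
    * by move=> p; rewrite div0n /s3 den_init_other // den_init.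
    * by move=> p; rewrite mod0n /s3 den_init.
    * by move=> p; rewrite /s3 !den_init_other //= updE.
    * by move=> p; right.
    * by rewrite /s3 !den_init_other //= updN.
  + move=> m s5 mL [row5 col5 cnt5 _ last5]; rewrite /inner 2!den_seq.
    set s6 := den L (Assign _ _) _; set s7 := den L (If _ _ _) s6.
    have s6E t : t != flag 0 -> t != t_pos -> s6 t = s5 t.
      by move=> t1 t2; rewrite /s6 /= !updN.
    have s7E t : t != flag 0 -> s7 t = s6 t.
      by move=> t1; rewrite /s7; cbn [den]; do 2!case: ifP => // _; rewrite updN.
    have [||||row7 col7] := @odometerP L s7 t_count c.+1 m.
    * by move=> p; rewrite s7E // s6E.
    * by move=> p; rewrite s7E // s6E.
    * by move=> p; rewrite s7E // s6E.
    * exact: cL.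
    split=> //.
    * by move=> p; rewrite den_frame // s7E // s6E.
    * move=> p; left; rewrite den_frame // /s7; cbn [den].
      have row6 : s6 t_row =1 pred1 (m %/ c.+1) by move=> q; rewrite s6E.
      have col6 : s6 t_col =1 pred1 (m %% c.+1) by move=> q; rewrite s6E.
      have cnt6 : s6 t_count =1 pred1 c by move=> q; rewrite s6E.
      have lt1 : m %/ c.+1 < L by apply: leq_ltn_trans (leq_div _ _) mL.
      have lt2 : m %% c.+1 < L by apply: leq_ltn_trans (leq_mod _ _) mL.
      rewrite (some_marked _ row6 lt1) (some_marked _ col6 lt2) !cnt6 /=.
      by do 2!case: eqP => _; rewrite /= ?updE.
    * by rewrite den_frame // s7E // s6E.
  set s5 := upd s4 _ _.
  have f5 p : s5 (flag 0) p = (c == n.-1).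
    rewrite /s5 updN // -last_position.
    by case: (f4 p) => [->|L0]; [rewrite L_gt0 | have := L_gt0; rewrite {1}L0].
  move=> p; rewrite [den _ _ _]/= (some_flag L_gt0 f5).
  case: eqP => [cE|cn] /=.
    by rewrite updE /= /s5 updN // cnt4 cE /= ltnSn andbT.
  rewrite /s5 updN // last4 I1; congr (_ && _).
  by apply/idP/idP; move: cn; lia.
rewrite /find_last -/inner E updN // => p; rewrite Is'.
by rewrite prednK // n_leL andbT.
Qed.

Lemma set_alive_frame s t : t \in persistent -> t != t_alive ->
  den L set_alive s t = s t.
Proof.
move=> tp tl; apply: den_frame; apply: contraNN tl => w.
have H : all (fun t => (t \in persistent) ==> (t == t_alive)) (writes set_alive).
  by vm_compute.
by have := allP H t w; rewrite tp.
Qed.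

Lemma set_alive_correct s : s t_last =1 pred1 n.-1 -> s t_alive =1 pred0 ->
  den L set_alive s t_alive =1 (fun p => p < n).
Proof.
move=> la al; rewrite /set_alive 2!den_seq.
set s3 := den L (init t_col) _; set inner := Seq _ _.
(* After [m] positions, row [p] has been met if and only if its first position, p times n, lies
   below [m]. *)
pose J m (s' : store) := [/\ s' t_row =1 pred1 (m %/ n),
    s' t_col =1 pred1 (m %% n), s' t_last = s t_last &
    s' t_alive =1 (fun p => p * n < m)].
have [||s4 [_ _ _ al4] ->] := @den_for J L t_pos inner s3.
- split.
  + by move=> p; rewrite div0n /s3 den_init_other // den_init.
  + by move=> p; rewrite mod0n /s3 den_init.
  + by rewrite /s3 !den_init_other.
  + by move=> p; rewrite /s3 !den_init_other // al.
- move=> m s5 mL [row5 col5 la5 al5]; rewrite /inner den_seq.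
  set s6 := den L (Assign _ _) _.
  have s6E t : t != t_alive -> t != t_pos -> s6 t = s5 t.
    by move=> t1 t2; rewrite /s6 /= !updN.
  have [||||row7 col7] := @odometerP L s6 t_last n m.
  + by move=> p; rewrite s6E.
  + by move=> p; rewrite s6E.
  + by move=> p; rewrite s6E // la5.
  + by rewrite n_gt0.
  split=> //.
  + by rewrite den_frame // s6E.
  + move=> p; rewrite den_frame // /s6 /= updE /= !updN // al5 row5 /=.
    rewrite -negb_or negbK ltnS -leq_divRL //.
    apply/orP/idP => [[lt|/eqP->//]|]; first by rewrite leq_divRL // ltnW.
    rewrite leq_eqVlt => /orP[|lt]; [by right | left].
    by move: lt; rewrite leq_divRL // mulSn; lia.
by move=> p; rewrite updN // al4 ltn_mul2r n_gt0.
Qed.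

Lemma main_correct s : (forall x y, s t_graph (x * n + y) = e x y) ->
  (forall t, t != t_graph -> s t =1 pred0) ->
  den L main s t_out =1 (fun p => p < spent (scans L)).
Proof.
move=> g0 s0; rewrite /main 2!den_seq.
set s1 := den L find_last s; set s2 := den L set_alive s1.
have la1 : s1 t_last =1 pred1 n.-1 by apply: find_last_correct; apply: s0.
have rep : represents s2 (initial n).
  split=> [|p|p|p|p].
  - split=> [p|x y]; first by rewrite /s2 set_alive_frame.
    by rewrite /s2 set_alive_frame // /s1 find_last_frame.
  - rewrite /s2 set_alive_correct //; last first.
      by move=> q; rewrite /s1 find_last_frame // s0.
    apply/idP/idP => [lt|]; last exact: mem_nat_lt.
    by apply/exists_inP; exists (Ordinal lt); rewrite //= inE.
  - rewrite /s2 set_alive_frame // /s1 find_last_frame // s0 //=.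
    by apply/esym/negbTE/exists_inPn => x; rewrite inE.
  - rewrite /s2 set_alive_frame // /s1 find_last_frame // s0 //=.
    by apply/esym/negbTE/exists_inPn => x; rewrite inE.
  - by rewrite /s2 set_alive_frame // /s1 find_last_frame // s0.
by case: (loops_correct rep).
Qed.

(** * Termination and optimality of the greedy scans *)

Hypotheses (esym : symmetric e) (eirr : irreflexive e) (blk : block_graph e).

Lemma step_nat_shrinks i j : shrinks (step_nat i j).
Proof.
rewrite /step_nat => st; case: insub => [x|]; last by left.
case: insub => [y|]; [exact: step_shrinks | by left].
Qed.

Lemma scan_shrinks : shrinks scan.
Proof.
apply: foldl_shrinks => i; apply: foldl_shrinks => j; exact: step_nat_shrinks.
Qed.

Lemma scan_progress st : alive st != set0 -> #|alive (scan st)| < #|alive st|.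
Proof.
case/(enabled_exists esym eirr blk) => x [y /step_enabled[lt _]].
have iL (z : 'I_n) : nat_of_ord z \in iota 0 L.
  by rewrite mem_iota (leq_trans (ltn_ord z)).
apply: (foldl_progress _ (iL x)) => [i|].
  by apply: foldl_shrinks => j; apply: step_nat_shrinks.
apply: (foldl_progress _ (iL y)) => [j|]; first exact: step_nat_shrinks.
by rewrite /step_nat !valK.
Qed.

(** Each scan of a nonempty graph meets an enabled pair and removes a vertex, so n rounds, and a
    fortiori n^2, empty the graph. *)
Lemma scans_bound m : #|alive (scans m)| <= n - m /\
  spent (scans m) + #|alive (scans m)| <= n.
Proof.
elim: m => [|m [IH1 IH2]].
  by rewrite subn0 /= cardsT card_ord add0n.
rewrite /scans iterS -/(scans m).
case: (eqVneq (alive (scans m)) set0) => [E|ne].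
  case: (scan_shrinks (scans m)) => [->|[]]; last by rewrite E cards0.
  by rewrite E cards0 in IH2 *.
have lt := scan_progress ne.
split; first by rewrite subnS -ltnS; apply: leq_trans lt _;
  case: (n - m) IH1 => // /leq_trans; apply.
case: (scan_shrinks (scans m)) => [->//|[_ le]]; exact: leq_trans le IH2.
Qed.

Lemma scan_mincost st c : mincost e (scan st) c -> mincost e st c.
Proof.
have H (F : nat -> state n -> state n) l st' : (forall i st, mincost e (F i st) c ->
    mincost e st c) -> mincost e (foldl (fun st i => F i st) st' l) c ->
    mincost e st' c.
  by move=> HF; elim: l st' => //= i l IH st' /IH/HF.
apply: (H _ _) => i {}st; apply: (H (step_nat i)) => j {}st; rewrite /step_nat.
case: insub => [x|] //; case: insub => [y|] //; exact: step_mincost.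
Qed.

Lemma scans_coboxicity : coboxicity_is e (spent (scans L)).
Proof.
apply: mincost_coboxicity => //.
have H m : mincost e (scans m) (spent (scans L)) ->
    mincost e (initial n) (spent (scans L)).
  by elim: m => //= m IH /scan_mincost/IH.
apply: (H L).
have [le _] := scans_bound L.
have al0 : alive (scans L) = set0.
  by apply/eqP; rewrite -cards_eq0 -leqn0 (leq_trans le) // leqn0 subn_eq0.
(* No vertex is left, so the empty family is a solution and the cost spent is the optimum. *)
split; last by move=> P _; apply: leq_addl.
by exists [::] => //; split=> // [v|a b]; rewrite al0 inE.
Qed.

Lemma scans_spent : spent (scans L) <= L.
Proof. by have [_ le] := scans_bound L; lia. Qed.

End Correctness.

(** * From programs to Turing machines *)

Lemma nth_encode_graph n (e : rel 'I_n) (x y : 'I_n) :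
  nth false (encode_graph e) (x * n + y) = e x y.
Proof.
have n_gt0 : 0 < n by apply: leq_ltn_trans (ltn_ord x).
have lt : x * n + y < n * n by have := ltn_ord x; have := ltn_ord y; nia.
rewrite (nth_map 0) ?size_iota // nth_iota // add0n.
rewrite divnMDl // modnMDl divn_small // modn_small // addn0.
apply/existsP/idP => [[a /existsP[b /and3P[/eqP/val_inj-> /eqP/val_inj->]]]|exy] //.
by exists x; apply/existsP; exists y; rewrite !eqxx.
Qed.

Definition load_cell (b : bool) : cell 100 :=
  [ffun i : 'I_100 => (val i == t_graph) && b].
Definition cell_out (c : cell 100) : bool := getc c t_out.
Definition load (b : seq bool) : store :=
  fun t i => (t == t_graph) && nth false b i.

Lemma tape_of_load b :
  tape_of 100 (size b) (load b) = [seq load_cell x | x <- b].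
Proof.
apply: (@eq_from_nth _ (load_cell false)); first by rewrite size_mkseq size_map.
by move=> i; rewrite size_mkseq => lt; rewrite nth_mkseq // (nth_map false).
Qed.

Lemma prog_machine p : wf 100 p -> exists (M : TM) (c k : nat),
  forall b res, res <= size b ->
    (0 < size b -> den (size b) p (load b) t_out =1 (fun i => i < res)) ->
    exists t, [/\ t <= c * (size b).+1 ^ k, halted (tm_run (tm_init M b) t) &
      tm_output (tm_run (tm_init M b) t) res].
Proof.
move=> wfp; have [c0 [d cost_le]] := cost_poly p.
exists (tm_of (compile 100 p 0) load_cell cell_out), (2 * c0 + 3), d.+1.
move=> b res le_res outE; case: (posnP (size b)) => [/size0nil b0|L_gt0].
  rewrite b0 leqn0 in le_res *; rewrite (eqP le_res).
  exists 0; split=> //; first exact: tm_of_empty.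
  split=> // /(congr1 (@decs _)).
  by rewrite sym_bitK [c_tape _ _]/= /sym_blank decs0.
have {}outE := outE L_gt0.
have [k le_k] := compile_correct (load b) [::] [::] wfp L_gt0.
rewrite cat0s cats0 tape_of_load [size [::]]/= add0n
  -{1}(size_compile 100 p 0) => run.
have [t le_t [hlt tapeF]] := tm_of_correct cell_out L_gt0 run.
exists t; split=> //.
  apply: leq_trans le_t _; rewrite expnS.
  have := cost_le (size b); have : 0 < (size b).+1 ^ d by rewrite expn_gt0.
  move: ((size b).+1 ^ d) => D; nia.
have tapeE i : i < size b -> decs (c_tape (tm_run (tm_init
    (tm_of (compile 100 p 0) load_cell cell_out) b) t) i) = Some (inl (i < res)).
  move=> lt; rewrite tapeF (nth_map (load_cell false)) ?size_mkseq //.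
  by rewrite nth_mkseq // /cell_out getc_at // bitsK outE.
have tape_bit i : i < res -> c_tape (tm_run (tm_init
    (tm_of (compile 100 p 0) load_cell cell_out) b) t) i = sym_bit _ true.
  move=> lt; have ltb := leq_trans lt le_res.
  rewrite tapeF (nth_map (load_cell false)) ?size_mkseq //.
  by rewrite nth_mkseq // /cell_out getc_at // outE lt.
split=> //; case: (ltnP res (size b)) => lt.
  by move/(congr1 (@decs _)); rewrite sym_bitK tapeE // ltnn.
(* If the output fills the whole tape, the cell behind it is still blank. *)
rewrite tapeF nth_default ?size_map ?size_iota // => /(congr1 (@decs _)).
by rewrite sym_bitK decs0.
Qed.

Theorem theorem1 :
  exists (M : TM) (c k : nat),
    forall (n : nat) (e : rel 'I_n),
      simple_graph e -> block_graph e ->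
      exists t res : nat,
        (t <= c * n.+1 ^ k)%N /\
        halted (tm_run (tm_init M (encode_graph e)) t) /\
        tm_output (tm_run (tm_init M (encode_graph e)) t) res /\
        coboxicity_is e res.
Proof.
have [M [c [d HM]]] := prog_machine wf_main.
(* The exponent doubles because the tape has n^2 cells and n^2 + 1 is at most (n + 1)^2. *)
exists M, c, (2 * d) => n e [esym eirr] blk.
have sizeE : size (encode_graph e) = n * n by rewrite size_map size_iota.
case: (posnP n) => [n0|n_gt0].
  have [|t [le_t hlt out]] := HM (encode_graph e) 0 (leq0n _).
    by have -> : size (encode_graph e) = 0 by rewrite sizeE n0.
  exists t, 0; split; last split=> //; last split=> //.
    by move: le_t; rewrite sizeE {1 2}n0 exp1n n0 exp1n.
  split=> //; exists (fun _ _ => R0), (fun _ _ => R0).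
  by split=> [v|u]; exfalso; [have := ltn_ord v | have := ltn_ord u];
    rewrite {2}n0.
have [||t [le_t hlt out]] := HM (encode_graph e) (spent (scans e (n * n))).
- by rewrite sizeE; apply: scans_spent.
- move=> _; rewrite sizeE; apply: main_correct => // [x y|t ne i].
    by rewrite /load nth_encode_graph.
  by rewrite /load (negPf ne).
exists t, (spent (scans e (n * n))); split; last first.
  by split=> //; split=> //; apply: scans_coboxicity.
apply: leq_trans le_t _; rewrite leq_mul2l expnM sizeE.
by apply/orP; right; case: (d) => [|d'] //; rewrite leq_exp2r //; nia.
Qed.
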